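(* Tree-Contractibility, parameterized by $k$, does not have a kernel of size polynomial in $k$, unless coNP $\subseteq$ NP/poly.
   Context: All graphs are finite, undirected and simple. Contracting an edge $xy$ removes $x$ and $y$ and replaces them by a new vertex adjacent to exactly the vertices adjacent to at least one of $x,y$. A graph $G$ is $k$-contractible to $H$ if $H$ can be obtained from $G$ by at most $k$ edge contractions. Tree-Contractibility: given a graph $G$ and an integer $k$ (the parameter), decide whether $G$ is $k$-contractible to a tree. A kernel for a parameterized problem is a polynomial-time algorithm mapping each instance $(I,k)$ to an equivalent instance $(I',k')$ (same yes/no answer) with $|I'|\le g(k)$; it is polynomial if $g$ is a polynomial. *)

(* Defs.v *)
From HB Require Import structures.
From mathcomp Require Import all_boot all_order all_algebra.
Set Implicit Arguments.
Unset Strict Implicit.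
Unset Printing Implicit Defensive.
Import GRing.Theory.

Record sgraph (V : finType) := SGraph {
  adj :> rel V;
  adj_sym : symmetric adj;
  adj_irr : irreflexive adj }.

(* The new vertex is [None]. *)
Definition contract_vertex (V : finType) (x y : V) : finType :=
  option {v : V | v \notin [:: x; y]}.

Definition contract_adj (V : finType) (G : sgraph V) (x y : V) :
    rel (contract_vertex x y) :=
  fun a b => match a, b with
  | Some u, Some v => G (val u) (val v)
  | Some u, None => G x (val u) || G y (val u)
  | None, Some v => G x (val v) || G y (val v)
  | None, None => false
  end.

Lemma contract_adj_sym (V : finType) (G : sgraph V) (x y : V) :
  symmetric (@contract_adj V G x y).
Proof. by case=> [u|] [v|] //=; apply: adj_sym. Qed.

Lemma contract_adj_irr (V : finType) (G : sgraph V) (x y : V) :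
  irreflexive (@contract_adj V G x y).
Proof. by case=> [u|] //=; apply: adj_irr. Qed.

Definition contract (V : finType) (G : sgraph V) (x y : V) :
    sgraph (contract_vertex x y) :=
  SGraph (@contract_adj_sym V G x y) (@contract_adj_irr V G x y).

Definition graph_iso (V W : finType) (G : sgraph V) (H : sgraph W) : Prop :=
  exists f : V -> W, bijective f /\ forall x y, H (f x) (f y) = G x y.

Inductive contractible_to (W : finType) (H : sgraph W) :
    nat -> forall V : finType, sgraph V -> Prop :=
| ContractDone (k : nat) (V : finType) (G : sgraph V) :
    graph_iso G H -> contractible_to H k G
| ContractEdge (k : nat) (V : finType) (G : sgraph V) (x y : V) :
    G x y -> contractible_to H k (contract G x y) -> contractible_to H k.+1 G.

Definition is_connected (V : finType) (G : sgraph V) : Prop :=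
  0 < #|V| /\ forall x y : V, connect G x y.

(* Traversing one edge back and forth is a [ucycle] of size 2. *)
Definition acyclic (V : finType) (G : sgraph V) : Prop :=
  forall c : seq V, ucycle G c -> size c < 3.

Definition is_tree (V : finType) (G : sgraph V) : Prop :=
  is_connected G /\ acyclic G.

Definition tree_contractible (V : finType) (G : sgraph V) (k : nat) : Prop :=
  exists (W : finType) (T : sgraph W), is_tree T /\ contractible_to T k G.

(* Deterministic multi-tape Turing machines with two-way infinite tapes; on
   the tape alphabet, [None] is the blank and [Some (inl b)] an input/output
   bit. *)
Inductive move := MoveLeft | Stay | MoveRight.

Record tm := TM {
  tm_tapes : nat;       (* the number of tapes minus one *)
  tm_aux : finType;
  tm_state : finType;
  tm_start : tm_state;
  tm_halt : pred tm_state;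
  tm_delta : tm_state -> {ffun 'I_tm_tapes.+1 -> option (bool + tm_aux)} ->
    tm_state * ('I_tm_tapes.+1 -> option (bool + tm_aux) * move) }.

Definition tm_sym (M : tm) : finType := option (bool + tm_aux M).

(* [(l, r)]: the head is on the first symbol of [r], and [l] lists the cells on
   its left, nearest first; all cells beyond [l] and [r] are blank. *)
Definition tape (M : tm) : Type := (seq (tm_sym M) * seq (tm_sym M))%type.

Definition tape_read (M : tm) (t : tape M) : tm_sym M := head None t.2.

Definition tape_write (M : tm) (s : tm_sym M) (t : tape M) : tape M :=
  (t.1, s :: behead t.2).

Definition tape_move (M : tm) (d : move) (t : tape M) : tape M :=
  match d with
  | MoveLeft => (behead t.1, head None t.1 :: t.2)
  | Stay => t
  | MoveRight => (tape_read t :: t.1, behead t.2)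
  end.

Definition config (M : tm) : Type :=
  (tm_state M * ('I_(tm_tapes M).+1 -> tape M))%type.

Definition tm_init (M : tm) (x : seq bool) : config M :=
  (tm_start M,
   fun i => ([::], if i == ord0 then [seq Some (inl b) | b <- x] else [::])).

Definition tm_step (M : tm) (c : config M) : config M :=
  if tm_halt c.1 then c else
  let a := tm_delta c.1 [ffun i => tape_read (c.2 i)] in
  (a.1, fun i => tape_move (a.2 i).2 (tape_write (a.2 i).1 (c.2 i))).

Fixpoint bits_prefix (A : Type) (s : seq (option (bool + A))) : seq bool :=
  if s is Some (inl b) :: s' then b :: bits_prefix s' else [::].

(* The output is the maximal block of bits on the first tape that starts at
   the head. *)
Definition tm_output (M : tm) (c : config M) : seq bool :=
  bits_prefix (c.2 ord0).2.

Definition tm_computes (M : tm) (x y : seq bool) (t : nat) : Prop :=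
  let c := iter t (@tm_step M) (tm_init M x) in
  tm_halt c.1 /\ tm_output c = y.

Definition poly_time (A B : Type) (codeA : A -> seq bool)
    (codeB : B -> seq bool) (f : A -> B) : Prop :=
  exists (M : tm) (p : {poly nat}),
    forall a : A, tm_computes M (codeA a) (codeB (f a)) p.[size (codeA a)]%R.

Definition code_bool (b : bool) : seq bool := [:: b].

(* Every bit of [x] is preceded by [true]; [false] marks the end of [x]. *)
Definition code_pair (xy : seq bool * seq bool) : seq bool :=
  flatten [seq [:: true; b] | b <- xy.1] ++ false :: xy.2.

Definition language : Type := seq bool -> Prop.

Definition NP (L : language) : Prop :=
  exists (V : seq bool * seq bool -> bool) (q : {poly nat}),
    poly_time code_pair code_bool V /\
    forall x, L x <-> exists u : seq bool, size u <= q.[size x]%R /\ V (x, u).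

Definition coNP (L : language) : Prop := NP (fun x => ~ L x).

Definition NP_poly (L : language) : Prop :=
  exists (L' : language) (advice : nat -> seq bool) (q : {poly nat}),
    [/\ NP L',
        forall n, size (advice n) <= q.[n]%R
      & forall x, L x <-> L' (code_pair (x, advice (size x)))].

Record param_problem := ParamProblem {
  instance : Type;
  code : instance -> seq bool;
  yes_instance : instance -> nat -> Prop }.

(* The parameter is written in unary, so that polynomial time means polynomial
   in [size (code I) + k]. *)
Definition code_param (P : param_problem) (Ik : instance P * nat) : seq bool :=
  code_pair (code Ik.1, nseq Ik.2 true).

Definition is_kernel (P : param_problem) (g : nat -> nat)
    (K : instance P * nat -> instance P * nat) : Prop :=
  [/\ poly_time (@code_param P) (@code_param P) K,
      forall I k, yes_instance I k <->
                  yes_instance (K (I, k)).1 (K (I, k)).2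
    & forall I k, size (code (K (I, k)).1) <= g k].

Definition has_polynomial_kernel (P : param_problem) : Prop :=
  exists (g : {poly nat}) (K : instance P * nat -> instance P * nat),
    is_kernel (fun k => g.[k]%R) K.

Definition graph : Type := {n : nat & sgraph 'I_n}.

(* The number of vertices in unary, then the adjacency matrix row by row. *)
Definition code_graph (G : graph) : seq bool :=
  nseq (tag G) true ++
  false :: [seq tagged G i j | i <- enum 'I_(tag G), j <- enum 'I_(tag G)].

Definition Tree_Contractibility : param_problem :=
  ParamProblem code_graph (fun (G : graph) k => tree_contractible (tagged G) k).

(* Main.v *)
Require Import Defs.
From HB Require Import structures.
From mathcomp Require Import all_boot all_order all_algebra zify.
From mathcomp Require Import boolp.
Set Implicit Arguments.
Unset Strict Implicit.
Unset Printing Implicit Defensive.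
Import GRing.Theory.

(** NP/poly contains every language [L] such that, for inputs of each length,
    membership is expressed by a formula of polynomial size with additional
    existential variables; the formula is the advice ([poly_cnf_NP_poly]).  As
    the advice need not be computable, no reduction below has to run in
    polynomial time: it only has to be small.

    Let the complement of [L] be in NP.  On inputs of length [n] it is expressed
    by such a formula [phi], obtained from the computation of the verifier.
    Given [2 ^ l] inputs, the question whether one of them satisfies [phi] is a
    set cover instance whose universe has size polynomial in [n] and [l], and
    the bits of this instance are literals in the bits of the inputs.  A set
    cover instance with universe [B] and budget [t] is the question whether the
    following graph is [#|B| + t]-contractible to a tree: a root is joined to
    [#|B| + t + 2] copies of every set, and each copy is joined to the elements
    of the set.  Indeed an element whose bag differs from that of the root lies
    on a 4-cycle of the contracted graph, and once all elements are in the bag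
    of the root, the sets in this bag cover them.

    If a kernel has size [g], one can choose [l = O(log n)] such that the kernel
    maps these graphs to graphs encoded by less than [2 ^ l] bits.  By the
    argument of Fortnow and Santhanam, [n + 1] of these values suffice to cover
    every input in [L] by a tuple of inputs in [L] that is mapped to one of them.
    Hence [x] is in [L] if and only if there is a tuple containing [x] whose
    image under the kernel is one of [n + 1] fixed no-instances, and the
    computation of the kernel is again expressed by a formula of polynomial
    size. *)

(** * Contraction maps *)

Definition fiber_rel (V W : finType) (G : sgraph V) (f : V -> W) : rel V :=
  [rel u v | G u v && (f u == f v)].

(** A whole sequence of contractions as one map: the fibers are the connected bags that are merged,
    and [H] is the quotient without loops. The number of contractions is then [#|V| - #|W|]. *)
Record contraction_map (V W : finType) (G : sgraph V) (H : sgraph W)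
    (f : V -> W) : Prop := ContractionMap {
  cmap_surj : forall w, exists v, f v = w;
  cmap_conn : forall u v, f u = f v -> connect (fiber_rel G f) u v;
  cmap_adj : forall w w', H w w' <->
    w <> w' /\ exists u v, [/\ f u = w, f v = w' & G u v] }.

Lemma sgraph_neq (V : finType) (G : sgraph V) (x y : V) : G x y -> x <> y.
Proof. by move=> /[swap] ->; rewrite adj_irr. Qed.

Lemma cmap_iso (V W : finType) (G : sgraph V) (H : sgraph W) (f : V -> W) :
  bijective f -> (forall x y, H (f x) (f y) = G x y) -> contraction_map G H f.
Proof.
case=> g fK gK fH; split=> [w|u v /(can_inj fK)->|w w']; first by exists (g w).
  exact: connect0.
split=> [Hww'|[_ [u [v [<- <-]]]]]; last by rewrite fH.
split; first exact: sgraph_neq Hww'.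
by exists (g w), (g w'); rewrite -fH !gK.
Qed.

Lemma cmap_comp (U V W : finType) (F : sgraph U) (G : sgraph V) (H : sgraph W)
    (f : U -> V) (g : V -> W) :
  contraction_map F G f -> contraction_map G H g ->
  contraction_map F H (g \o f).
Proof.
move=> Cf Cg; split=> [w|u v /= /(cmap_conn Cg)/connectP[p]|w w'].
- have [v <-] := cmap_surj Cg w; have [u <-] := cmap_surj Cf v.
  by exists u.
- have subf : subrel (connect (fiber_rel F f)) (connect (fiber_rel F (g \o f))).
    apply: connect_sub => x y /andP[Fxy /eqP fxy]; apply: connect1.
    by rewrite /fiber_rel /= Fxy fxy eqxx.
  elim: p u => [|a p IHp] u /= => [_ fvu|/andP[/andP[Ga ga] pa] fv].
    by apply/subf/(cmap_conn Cf).
  have [_ [u1 [v1 [fu1 fv1 Fuv]]]] := (cmap_adj Cf _ _).1 Ga.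
  apply: connect_trans (subf _ _ (cmap_conn Cf (esym fu1))) _.
  apply: (@connect_trans _ _ v1); first by apply: connect1; rewrite /fiber_rel /= Fuv fu1 fv1.
  by apply: IHp; rewrite fv1.
- split=> [/(cmap_adj Cg)[neq [a [b [ga gb /(cmap_adj Cf)]]]]|].
    case=> _ [u [v [fu fv Fuv]]]; split=> //.
    by exists u, v; rewrite /= fu fv.
  case=> neq [u [v [/= gfu gfv Fuv]]]; apply/(cmap_adj Cg); split=> //.
  exists (f u), (f v); split=> //; apply/(cmap_adj Cf); split.
    by move=> fuv; case: neq; rewrite -gfu -gfv fuv.
  by exists u, v.
Qed.

(** Serves to split the contraction of one edge off a contraction map: a path in a fiber of [g \o f]
    is mapped by [f] to a path with repetitions in a fiber of [g]. *)
Lemma cmap_factor (U V W : finType) (F : sgraph U) (G : sgraph V)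
    (H : sgraph W) (f : U -> V) (g : V -> W) :
  contraction_map F G f -> contraction_map F H (g \o f) ->
  contraction_map G H g.
Proof.
move=> Cf Cgf; split=> [w|a b gab|w w'].
- by have [u <-] := cmap_surj Cgf w; exists (f u).
- have [u fu] := cmap_surj Cf a; have [v fv] := cmap_surj Cf b.
  rewrite -fu -fv in gab *; have /connectP[p] := cmap_conn Cgf gab.
  move=> + ->; elim: p u {fu gab} => [|x p IHp] u /=; first by rewrite connect0.
  case/andP=> /andP[Fux /= gfux] px; apply: connect_trans (IHp _ px).
  have [->|/eqP fux] := eqVneq (f u) (f x); first exact: connect0.
  apply: connect1; rewrite /fiber_rel /= gfux andbT; apply/(cmap_adj Cf).
  by split=> //; exists u, x.
- split=> [/(cmap_adj Cgf)[neq [u [v [/= gfu gfv Fuv]]]]|].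
    split=> //; exists (f u), (f v); split=> //; apply/(cmap_adj Cf); split.
      by move=> fuv; case: neq; rewrite -gfu -gfv fuv.
    by exists u, v.
  case=> neq [a [b [ga gb /(cmap_adj Cf)[_ [u [v [fu fv Fuv]]]]]]].
  apply/(cmap_adj Cgf); split=> //; exists u, v.
  by rewrite /= fu fv.
Qed.

Definition contract_proj (V : finType) (x y v : V) : contract_vertex x y :=
  insub v.

Lemma contract_projE (V : finType) (x y v : V) :
  contract_proj x y v = None <-> v \in [:: x; y].
Proof.
rewrite /contract_proj; case: insubP => [u /negbTE-> _ //|].
by rewrite negbK => ->.
Qed.

Lemma cmap_contract (V : finType) (G : sgraph V) (x y : V) :
  G x y -> contraction_map G (contract G x y) (@contract_proj V x y).
Proof.
move=> Gxy; have Gyx : G y x by rewrite adj_sym.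
have pN v : v \in [:: x; y] -> contract_proj x y v = None.
  by move=> vxy; apply/contract_projE.
have pS (u : {v | v \notin [:: x; y]}) : contract_proj x y (val u) = Some u.
  exact: valK.
have Nx : contract_proj x y x = None by apply: pN; rewrite inE eqxx.
have Ny : contract_proj x y y = None by apply: pN; rewrite !inE eqxx orbT.
split=> [[u|]|u v|[u|] [v|]].
- by exists (val u).
- by exists x.
- have [uxy|uxy] := boolP (u \in [:: x; y]); last first.
    rewrite /contract_proj insubT; case: insubP => // v' _ <- [<-].
    exact: connect0.
  rewrite (pN u uxy) => /esym/contract_projE vxy.
  have [->|neq_uv] := eqVneq u v; first exact: connect0.
  apply: connect1; rewrite /fiber_rel /= (pN u) // (pN v) // eqxx andbT.
  move: uxy vxy neq_uv; rewrite !inE.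
  by case/orP=> /eqP-> /orP[]/eqP->; rewrite ?eqxx.
- split=> [/= Guv|].
    split; last by exists (val u), (val v).
    by case=> eq_uv; move: Guv; rewrite eq_uv adj_irr.
  case=> _ [u1 [v1 []]]; rewrite /contract_proj.
  by do 2![case: insubP => // ? _ <- [<-]].
- split=> [/= /orP[]Gu|].
  + by split=> //; exists (val u), x; rewrite adj_sym.
  + by split=> //; exists (val u), y; rewrite adj_sym.
  case=> _ [u1 [v1 []]]; rewrite /contract_proj.
  case: insubP => // ? _ <- [->]; case: insubP => // /[!negbK] vxy _ Guv.
  move: vxy Guv; rewrite !inE /= => /orP[]/eqP->; rewrite adj_sym => -> //.
  by rewrite orbT.
- split=> [/= /orP[]Gv|].
  + by split=> //; exists x, (val v).
  + by split=> //; exists y, (val v).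
  case=> _ [u1 [v1 []]]; rewrite /contract_proj.
  case: insubP => // /[!negbK] uxy _; case: insubP => // ? _ <- [->] Guv.
  move: uxy Guv; rewrite !inE /= => /orP[]/eqP-> -> //.
  by rewrite orbT.
- by split=> // -[].
Qed.

Lemma card_contract_vertex (V : finType) (x y : V) :
  x != y -> #|contract_vertex x y| = #|V|.-1.
Proof.
move=> neq; rewrite card_option card_sub.
have eqxy : [pred v | v \notin [:: x; y]] =i predC (mem [:: x; y]) by [].
have := cardC (mem [:: x; y]); rewrite -(eq_card eqxy) (card_uniqP _) /=; last first.
  by rewrite inE neq.
by move=> <-.
Qed.

Lemma cmap_card (V W : finType) (G : sgraph V) (H : sgraph W) (f : V -> W) :
  contraction_map G H f -> #|W| <= #|codom f|.
Proof.
move=> Cf; apply: subset_leq_card; apply/subsetP=> w _.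
by have [v <-] := cmap_surj Cf w; apply: codom_f.
Qed.

Lemma cmap_inj_iso (V W : finType) (G : sgraph V) (H : sgraph W) (f : V -> W) :
  contraction_map G H f -> injective f -> graph_iso G H.
Proof.
move=> Cf f_inj; exists f; split.
  by apply: (inj_card_bij f_inj); rewrite -(card_codom f_inj) (cmap_card Cf).
move=> x y; apply/idP/idP => [|Gxy].
  by case/(cmap_adj Cf)=> _ [u [v [/f_inj-> /f_inj->]]].
apply/(cmap_adj Cf); split; last by exists x, y.
by move/f_inj; apply: sgraph_neq Gxy.
Qed.

(** Each contraction removes one vertex. Conversely, a contraction map that is not injective has an
    edge inside a fiber, and it factors through the contraction of this edge. *)
Lemma contractible_cmap (W V : finType) (H : sgraph W) (G : sgraph V) k :
  contractible_to H k G <->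
  exists2 f, contraction_map G H f & #|V| <= #|W| + k.
Proof.
split.
  elim=> {k V G} [k V G [f [bij_f Hf]]|k V G x y Gxy _ [f Cf leVW]].
    exists f; first exact: cmap_iso.
    by rewrite (bij_eq_card bij_f) leq_addr.
  exists (f \o @contract_proj V x y); first exact: cmap_comp (cmap_contract Gxy) _.
  move: leVW; rewrite card_contract_vertex; last by apply/eqP; apply: sgraph_neq Gxy.
  by rewrite addnS; case: #|V|.
elim: k V G => [|k IHk] V G [f Cf leVW].
  apply: ContractDone; apply: (cmap_inj_iso Cf) => x y.
  suffices/image_injP f_inj: #|codom f| == #|V| by apply: f_inj.
  rewrite eqn_leq leq_image_card (leq_trans _ (cmap_card Cf)) //.
  by rewrite addn0 in leVW.
have [/injectiveP f_inj|/injectivePn[x [y' neq_xy fxy]]] := boolP (injectiveb f).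
  by apply: ContractDone; apply: cmap_inj_iso Cf f_inj.
have /connectP[[_ eq_xy|y p /= /andP[/andP[Gxy /eqP eq_fxy] _] _]] := cmap_conn Cf fxy.
  by rewrite eq_xy eqxx in neq_xy.
have neq : x != y by apply/eqP; apply: sgraph_neq Gxy.
apply: (ContractEdge Gxy); apply: IHk.
pose f' (a : contract_vertex x y) := if a is Some u then f (val u) else f x.
have eq_f : f' \o @contract_proj V x y =1 f.
  move=> v; rewrite /= /contract_proj; case: insubP => [u _ <- //|/=].
  by rewrite negbK !inE => /orP[]/eqP->.
exists f'; last first.
  rewrite card_contract_vertex //; move: leVW; rewrite addnS.
  by case: #|V| => //=.
apply: cmap_factor (cmap_contract Gxy) _.
case: Cf => Cs Cc Ca; split=> [w|u v|w w'].
- by have [v <-] := Cs w; exists v; rewrite eq_f.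
- rewrite !eq_f => /Cc; apply: connect_sub => a b /andP[Gab fab].
  apply: connect1; rewrite /fiber_rel /= Gab -[f' _]/((f' \o _) a) eq_f.
  by rewrite -[f' _]/((f' \o _) b) eq_f.
- split=> [/Ca[neqw [u [v []]]]|[neqw [u [v []]]]]; last first.
    by rewrite !eq_f => fu fv Guv; apply/Ca; split=> //; exists u, v.
  by rewrite -!eq_f => fu fv Guv; split=> //; exists u, v.
Qed.

Lemma cmap_tree (V : finType) (G : sgraph V) (k : nat) :
  tree_contractible G k <->
  exists (W : finType) (T : sgraph W) (f : V -> W),
    [/\ is_tree T, contraction_map G T f & #|V| <= #|W| + k].
Proof.
split=> [[W [T [treeT /contractible_cmap[f Cf leVW]]]]|].
  by exists W, T, f.
case=> W [T [f [treeT Cf leVW]]]; exists W, T; split=> //.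
by apply/contractible_cmap; exists f.
Qed.

Lemma tree_contractible_leq (V : finType) (G : sgraph V) (k k' : nat) :
  k <= k' -> tree_contractible G k -> tree_contractible G k'.
Proof.
move=> lek /cmap_tree[W [T [f [treeT Cf leVW]]]]; apply/cmap_tree.
exists W, T, f; split=> //; apply: leq_trans leVW _.
by rewrite leq_add2l.
Qed.

Lemma tree_contractible_iso (V V' : finType) (G : sgraph V) (G' : sgraph V')
    (k : nat) :
  graph_iso G G' -> tree_contractible G' k -> tree_contractible G k.
Proof.
move=> [h [bij_h hG]] /cmap_tree[W [T [f [treeT Cf leVW]]]]; apply/cmap_tree.
exists W, T, (f \o h); split=> //; last by rewrite (bij_eq_card bij_h).
exact: cmap_comp (cmap_iso bij_h hG) Cf.
Qed.

(** * Set cover as tree contraction *)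

Section SetCover.
Variables (B R : finType) (t : nat).

Definition cover_param : nat := #|B| + t.

(** [None] is the root and [inr (r, c)] is the copy [c] of the set [r]. With two copies more than
    contractions, the copies of a set lie in at least two bags besides those of the root and of a
    given element. *)
Definition cover_vertex : finType := option (B + R * 'I_(cover_param).+2).

(* Stated over an arbitrary type [X] of entries, so that the same matrix can be
   filled with bits or with literals. *)
Definition cover_entry (X : Type) (x0 x1 : X) (cov : R -> B -> X)
    (u v : cover_vertex) : X :=
  match u, v with
  | None, Some (inr _) | Some (inr _), None => x1
  | Some (inl b), Some (inr (r, _)) | Some (inr (r, _)), Some (inl b) => cov r b
  | _, _ => x0
  end.

Lemma cover_entry_map (X Y : Type) (h : X -> Y) x0 x1 cov u v :
  h (@cover_entry X x0 x1 cov u v) =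
  cover_entry (h x0) (h x1) (fun r b => h (cov r b)) u v.
Proof. by case: u v => [[b|[r c]]|] [[b'|[r' c']]|]. Qed.

Variable cov : R -> B -> bool.

Definition cover_adj : rel cover_vertex := cover_entry false true cov.

Lemma cover_adj_sym : symmetric cover_adj.
Proof. by case=> [[b|[r c]]|] [[b'|[r' c']]|]. Qed.

Lemma cover_adj_irr : irreflexive cover_adj.
Proof. by case=> [[b|[r c]]|]. Qed.

Definition cover_graph : sgraph cover_vertex := SGraph cover_adj_sym cover_adj_irr.

(** The tree that a cover yields: the root, all elements and one copy of each chosen set are merged
    into the center, and the remaining copies become leaves. *)
Definition star (V : finType) : rel (option V) := fun a b => (a == None) != (b == None).

Lemma star_sym (V : finType) : symmetric (@star V).
Proof. by move=> a b; rewrite /star eq_sym. Qed.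

Lemma star_irr (V : finType) : irreflexive (@star V).
Proof. by move=> a; rewrite /star eqxx. Qed.

Definition star_graph (V : finType) : sgraph (option V) :=
  SGraph (@star_sym V) (@star_irr V).

Lemma star_tree (V : finType) : is_tree (star_graph V).
Proof.
split.
  split; first by rewrite card_option.
  have cN (a : option V) : connect (star_graph V) None a.
    by case: a => [a|]; [apply: connect1 | apply: connect0].
  move=> a b; apply: connect_trans (cN b).
  by rewrite (sym_connect_sym (@star_sym V)).
case=> [|a [|b [|c s]]] // /andP[/=].
rewrite /star !inE; case: a b c => [a|] [b|] [c|] //=; rewrite ?eqxx ?andbF ?orbF //=.
by case: s => [|[d|] s] //= _; rewrite ?inE ?andbF.
Qed.

Lemma cover_contractible :
  tree_contractible cover_graph cover_param <->
  exists N : {set R}, #|N| <= t /\ forall b, exists2 r, r \in N & cov r b.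
Proof.
split=> [/cmap_tree[W [T [f [[[_ Tconn] Tacyc] Cf leVW]]]]|[N [leNt covN]]].
- have nbr b v : cover_graph (Some (inl b)) v -> exists r c, v = Some (inr (r, c)) /\ cov r b.
    by case: v => [[b'|[r c]]|] //= cov_rb; exists r, c.
  have fb b : f (Some (inl b)) = f None.
    apply/eqP/negPn/negP => neq_fb.
    (* An edge of the connected tree leaves the bag of [b]; it starts in [b] itself, or else a path
       inside the bag does. *)
    have [r cov_rb] : exists r, cov r b.
      have /connectP[[_ /eqP|w p /= /andP[Tw _] _]] := Tconn (f (Some (inl b))) (f None).
        by rewrite eq_sym (negbTE neq_fb).
      have [_ [u [v [fu _ Guv]]]] := (cmap_adj Cf _ _).1 Tw.
      have /connectP[[_ /= eq_u|v' p' /= /andP[/andP[Gv' _] _] _]] := cmap_conn Cf (esym fu).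
        by rewrite eq_u in Guv; have [r [_ [_ ?]]] := nbr _ _ Guv; exists r.
      by have [r [_ [_ ?]]] := nbr _ _ Gv'; exists r.
    pose S := (fun c => Some (inr (r, c)) : cover_vertex) @: [set: 'I_(cover_param.+2)].
    pose C := f @: S :\: [set f None; f (Some (inl b))].
    have cS : #|S| = cover_param.+2 by rewrite card_imset => [|? ? []//]; rewrite cardsT card_ord.
    (* The bags outside [C] number at most [#|~: S|], so fewer than two bags in [C] would require
       more than [cover_param] contractions. *)
    have : 1 < #|C|.
      have subW : [set: W] \subset (f @: (~: S)) :|: C.
        apply/subsetP=> w _; have [v <-] := cmap_surj Cf w; rewrite !inE.
        have [vS|vS] := boolP (v \in S); last by rewrite imset_f ?inE.
        rewrite [f v \in f @: S]imset_f // andbT.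
        have [/orP[]/eqP->|] := boolP ((_ == _) || _); rewrite ?orbT //.
          by rewrite imset_f // inE; apply/imsetP=> -[].
        by rewrite imset_f // inE; apply/imsetP=> -[].
      have := leq_trans (subset_leq_card subW) (leq_card_setU _ _).
      rewrite cardsT => leW; have leS := leq_imset_card f (~: S).
      have := cardsC S; rewrite cS => eqV; move: leVW; rewrite -eqV.
      move=> leVW; have := leq_trans leVW (leq_add leW (leqnn cover_param)).
      move/leq_trans/(_ (leq_add (leq_add leS (leqnn #|C|)) (leqnn _))).
      by lia.
    case/card_gt1P=> w1 [w2 []]; rewrite !inE !negb_or.
    case/andP=> /andP[n1a n1b] /imsetP[_ /imsetP[c1 _ ->] e1].
    case/andP=> /andP[n2a n2b] /imsetP[_ /imsetP[c2 _ ->] e2] neq12.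
    have Tadj u v : cover_graph u v -> f u != f v -> T (f u) (f v).
      by move=> Guv neq; apply/(cmap_adj Cf); split; [apply/eqP | exists u, v].
    suffices : ucycle T [:: w1; f None; w2; f (Some (inl b))] by move/Tacyc.
    rewrite /ucycle /= !inE !negb_or n1a n1b neq12 n2b eq_sym n2a eq_sym neq_fb !andbT /=.
    by rewrite e1 e2 in n1a n1b n2a n2b *; rewrite !Tadj //= eq_sym.
  pose S := [set v | f v == f None].
  (* Merging the bag of the root alone takes [#|S| - 1] contractions. *)
  have leS : #|S| <= cover_param.+1.
    have subW : [set: W] \subset f None |: (f @: (~: S)).
      apply/subsetP=> w _; have [v <-] := cmap_surj Cf w; rewrite !inE.
      by have [//|neq] := eqVneq (f v) (f None); rewrite imset_f // !inE.
    have := subset_leq_card subW; rewrite cardsT => /leq_trans/(_ (leq_card_setU _ _)).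
    rewrite cards1 => /leq_trans/(_ (leq_add (leqnn 1) (leq_imset_card f _))) leW.
    have := leq_trans leVW (leq_add leW (leqnn _)); rewrite -(cardsC S).
    by lia.
  pose N := [set r | [exists c, f (Some (inr (r, c))) == f None]].
  exists N; split; last first.
    move=> b.
    have /connectP[[_ //|v p /= /andP[/andP[Gv /eqP fv] _] _]] := cmap_conn Cf (fb b).
    have [r [c [eq_v cov_rb]]] := nbr _ _ Gv; exists r => //.
    by rewrite inE; apply/existsP; exists c; rewrite -eq_v -fv fb.
  have ex_c (r : {r | r \in N}) : exists c, f (Some (inr (val r, c))) == f None.
    by apply/existsP; have := valP r; rewrite inE.
  (* The bag of the root contains the root, all elements and a copy of each member of [N], hence
     [1 + #|B| + #|N| <= #|B| + t + 1]. *)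
  pose h (x : option (B + {r | r \in N})) : cover_vertex :=
    match x with
    | None => None
    | Some (inl b) => Some (inl b)
    | Some (inr r) => Some (inr (val r, xchoose (ex_c r)))
    end.
  have h_inj : injective h.
    by move=> [[b|r]|] [[b'|r']|] //= [] => [->|/val_inj->].
  have : #|h @: setT| <= #|S|.
    apply: subset_leq_card; apply/subsetP=> _ /imsetP[x _ ->]; rewrite inE.
    case: x => [b|]; last exact: eqxx.
    by case: b => [b|r]; [rewrite /= fb | exact: (xchooseP (ex_c r))].
  move/leq_trans/(_ leS); rewrite card_imset // cardsT card_option card_sum card_sig.
  by rewrite ltnS leq_add2l; congr (_ <= _); apply: eq_card => r; rewrite inE.
- pose D : {set cover_vertex} :=
    [set v | if v is Some (inr (r, c)) then (r \in N) && (c == ord0) else true].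
  have leD : #|D| <= cover_param.+1.
    pose D' := None |: ((fun b => Some (inl b) : cover_vertex) @: [set: B] :|:
      (fun r => Some (inr (r, ord0)) : cover_vertex) @: N).
    have /subset_leq_card/leq_trans->// : D \subset D'.
      apply/subsetP=> -[[b|[r c]]|] //; rewrite !inE //=.
        by rewrite imset_f.
      by case/andP=> rN /eqP->; rewrite [X in _ || X]imset_f ?orbT.
    apply: leq_trans (leq_card_setU _ _) _; rewrite cards1 add1n ltnS.
    apply: leq_trans (leq_card_setU _ _) _; apply: leq_add.
      by rewrite -cardsT leq_imset_card.
    exact: leq_trans (leq_imset_card _ _) leNt.
  apply/cmap_tree; pose f (v : cover_vertex) : option {v | v \notin D} := insub v.
  have fD v : v \in D -> f v = None by move=> vD; rewrite /f insubN // negbK.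
  have fDP v : f v = None -> v \in D by rewrite /f; case: insubP => //; rewrite negbK.
  have DN : None \in D by rewrite inE.
  have Db b : Some (inl b) \in D by rewrite inE.
  exists (option {v | v \notin D}), (star_graph _), f; split; first exact: star_tree.
    split=> [[w|]|u v|w w'].
    + by exists (val w); rewrite /f valK.
    + by exists None; rewrite fD.
    + have [uD|uD] := boolP (u \in D); last first.
        by rewrite {1}/f insubT /f; case: insubP => // v' _ <- [<-]; rewrite connect0.
      rewrite (fD u uD) => /esym/fDP vD.
      have step x y : x \in D -> y \in D -> cover_graph x y ->
          connect (fiber_rel cover_graph f) x y.
        by move=> xD yD xy; apply: connect1; apply/andP; rewrite !fD.
      have cN x : x \in D -> connect (fiber_rel cover_graph f) None x.
        case: x => [[b|[r c]]|] xD; last exact: connect0.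
          have [r rN cov_rb] := covN b.
          have rD : Some (inr (r, ord0)) \in D by rewrite inE rN eqxx.
          by apply: (@connect_trans _ _ (Some (inr (r, ord0)))); apply: step.
        exact: step.
      have fsym : symmetric (fiber_rel cover_graph f).
        by move=> x y; congr (_ && _); [apply: adj_sym | apply: eq_sym].
      by apply: connect_trans (cN v vD); rewrite (sym_connect_sym fsym) cN.
    + split=> [|[neq [u [v [eq_u eq_v Guv]]]]].
        have fval (x : {v | v \notin D}) : f (val x) = Some x by apply: valK.
        have adjN (x : {v | v \notin D}) : cover_graph None (val x).
          by move: (valP x); case: (val x) => [[b|rc]|] //; rewrite ?Db ?DN.
        case: w w' => [w|] [w'|] //= _; split=> //.
          exists (val w), None; rewrite fval fD //; split=> //.
          by rewrite cover_adj_sym; apply: adjN.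
        by exists None, (val w'); rewrite fval fD //; split=> //; apply: adjN.
      have fS x a : f x = Some a -> exists rc, x = Some (inr rc).
        by case: x => [[b|rc]|]; [rewrite fD | exists rc | rewrite fD].
      move: neq; rewrite /= /star.
      case: w w' eq_u eq_v => [a|] [a'|] //= /fS[[r c] eu] /fS[[r' c'] ev].
      by move: Guv; rewrite eu ev.
  have -> : #|{: option {v | v \notin D}}| = #|~: D|.+1.
    rewrite card_option card_sig; congr _.+1.
    by apply: eq_card => v; rewrite in_setC.
  by have := cardsC D; lia.
Qed.
End SetCover.

(** * Formulas in conjunctive normal form *)

Definition cnf (V : Type) : Type := seq (seq (V * bool)).

Definition lit_holds (V : Type) (rho : V -> bool) (l : V * bool) : bool :=
  rho l.1 == l.2.

Definition sat (V : Type) (rho : V -> bool) (phi : cnf V) : bool :=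
  all (has (lit_holds rho)) phi.

Definition cnf_size (V : Type) (phi : cnf V) : nat :=
  sumn [seq (size c).+1 | c <- phi].

(** A bit that is either known or given by a literal; sequences of entries serve as templates of
    machine inputs. *)
Definition entry (V : Type) : Type := (bool + V * bool)%type.

Definition entry_val (V : Type) (rho : V -> bool) (e : entry V) : bool :=
  match e with inl b => b | inr l => lit_holds rho l end.

Definition sum_val (V A : Type) (f : V -> bool) (g : A -> bool) (x : V + A) : bool :=
  match x with inl v => f v | inr a => g a end.

Lemma sum_val_split (V A : Type) (rho : V + A -> bool) :
  rho =1 sum_val (fun v => rho (inl v)) (fun a => rho (inr a)).
Proof. by case. Qed.

Lemma eq_sat (V : Type) (rho sigma : V -> bool) :
  rho =1 sigma -> sat rho =1 sat sigma.
Proof.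
move=> eq_rs phi; apply: eq_all => c; apply: eq_has => x.
by rewrite /lit_holds eq_rs.
Qed.

Lemma size_flatten_pairs (A : Type) (a : A) (s : seq A) :
  size (flatten [seq [:: a; e] | e <- s]) = 2 * size s.
Proof. by elim: s => //= e s ->; rewrite mulnS. Qed.

Lemma size_code_pair (x y : seq bool) : size (code_pair (x, y)) = 2 * size x + 1 + size y.
Proof. by rewrite size_cat size_flatten_pairs /= addn1 addSnnS. Qed.

(** * The disjunction of many formulas as a set cover instance *)

Section OrCover.
Variables (n N l : nat) (phi : cnf nat).

Definition or_index : finType := {ffun 'I_l -> bool}.

(* To be covered: one element per color (the colors are the variables of [phi]
   and the additional color [None], which selects an instance), the clauses of
   [phi], and for each variable [v] and bit position [p] a pair of elements
   that forces the set chosen for [v] to belong to the selected instance. *)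
Definition or_elt : finType :=
  (option 'I_N + ('I_(size phi) + 'I_N * 'I_l * bool))%type.

(** The set [inl i] selects the instance [i]; the set [inr (i, v, s)] gives the variable [v] the
    value [s] on behalf of the instance [i]. *)
Definition or_set : finType := (or_index + or_index * 'I_N * bool)%type.

(** Only the colors [v < n] depend on the inputs: there [s] must be the bit [v] of the input [i].
    The sets [inl i] and [inr (i', v, s)] together cover the pair at [(v, p)] if and only if
    [i p = i' p]. *)
Definition or_entry (r : or_set) (b : or_elt) : entry (or_index * nat) :=
  match r, b with
  | inl i, inl None => inl true
  | inl i, inr (inr (v, p, b)) => inl (i p == b)
  | inr (i, v, s), inl (Some v') =>
      if v == v' then if v < n then inr ((i, nat_of_ord v), s) else inl true
      else inl false
  | inr (i, v, s), inr (inl c) => inl ((nat_of_ord v, s) \in nth [::] phi c)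
  | inr (i, v, s), inr (inr (v', p, b)) => inl ((v == v') && (i p != b))
  | _, _ => inl false
  end.

Lemma or_cover (rho : or_index * nat -> bool) :
  (forall c x, c \in phi -> x \in c -> x.1 < N) ->
  (exists S : {set or_set}, #|S| <= N.+1 /\
     forall b, exists2 r, r \in S & entry_val rho (or_entry r b)) <->
  exists i sigma, (forall j, j < n -> sigma j = rho (i, j)) /\ sat sigma phi.
Proof.
move=> ltN; split=> [[S [leS covS]]|[i [sigma [sigma_in sat_phi]]]].
  have exh (c : option 'I_N) :
      exists r, (r \in S) && entry_val rho (or_entry r (inl c)).
    by have [r rS rc] := covS (inl c); exists r; rewrite rS.
  pose h c := xchoose (exh c).
  pose col (r : or_set) := if r is inr (_, v, _) then Some v else None.
  have hP c : (h c \in S) && entry_val rho (or_entry (h c) (inl c)).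
    exact: (xchooseP (exh c)).
  have hS c : h c \in S by case/andP: (hP c).
  have hcov c : entry_val rho (or_entry (h c) (inl c)) by case/andP: (hP c).
  have colh c : col (h c) = c.
    by move: (hcov c); case: (h c) => [i|[[i v] s]]; case: (c) => [v'|] //=; case: eqVneq => [->|].

  (* Every color needs a set of its own and there are [N + 1] colors, so the budget leaves exactly
     one set per color. *)
  have eqS : S = h @: setT.
    apply/esym/eqP; rewrite eqEcard; apply/andP; split.
      by apply/subsetP=> _ /imsetP[c _ ->].
    by rewrite (card_imset _ (can_inj colh)) cardsT card_option card_ord.
  have hcol r : r \in S -> r = h (col r).
    by rewrite eqS => /imsetP[c _ ->]; rewrite colh.
  have [i hN] : exists i, h None = inl i.
    by case: (h None) (colh None) => [i|[[i v] s]] // _; exists i.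
  have hi v : exists s, h (Some v) = inr (i, v, s).
    case eq_h: (h (Some v)) (colh (Some v)) => [|[[iv v'] s]] //= [eq_v].
    rewrite eq_v {v' eq_v} in eq_h *; exists s; congr (inr (_, _, _)).
    apply/ffunP=> p.
    (* The set [inl i] misses this element of the pair, so the set chosen for [v] has to cover
       it. *)
    have [r rS] := covS (inr (inr (v, p, ~~ i p))).
    rewrite (hcol r rS); case: (col r) => [v'|]; last first.
      by rewrite hN /=; case: (i p).
    have := colh (Some v'); case eq_h': (h _) => [|[[iv' v''] s']] //= [->].
    case: eqVneq => //= eq_v; move: eq_h'; rewrite eq_v eq_h => -[-> _].
    by case: (iv' p) (i p) => [] [].
  pose s v := if h (Some v) is inr (_, _, s) then s else false.
  (* A variable [j >= N] does not occur in [phi]; there [sigma] copies the input, since [n] may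
     exceed [N]. *)
  pose sigma j := if insub j is Some v then s v else rho (i, j).
  exists i, sigma; split=> [j ltjn|].
    rewrite /sigma; case: insubP => // v _ eq_j; rewrite /s.
    have := hcov (Some v); have [b ->] /= := hi v.
    by rewrite eqxx eq_j ltjn /= /lit_holds /= => /eqP.
  apply/allP=> c /[dup] cphi /(nthP [::])[k ltk eq_c]; apply/hasP.
  have [r rS] := covS (inr (inl (Ordinal ltk))); rewrite (hcol r rS).
  case: (col r) => [v|]; last by rewrite hN.
  have [b hv] := hi v; rewrite hv /= eq_c => vc; exists (nat_of_ord v, b) => //.
  by rewrite /lit_holds /sigma /= valK /s hv.
pose g (c : option 'I_N) : or_set :=
  if c is Some v then inr (i, v, sigma v) else inl i.
exists (g @: setT); split.
  by rewrite -(card_ord N.+1) (leq_trans (leq_imset_card _ _)) // cardsT card_option !card_ord.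
have gS c : g c \in g @: setT by apply: imset_f.
case=> [c|[k|[[v p] b]]].
- exists (g c) => //; case: c => //= v; rewrite eqxx; case: ifP => //= ltvn.
  by rewrite /lit_holds /= sigma_in.
- have kphi : nth [::] phi k \in phi by apply: mem_nth.
  have /hasP[[v s] vk] := allP sat_phi _ kphi; rewrite /lit_holds /= => /eqP eq_s.
  exists (g (Some (Ordinal (ltN _ _ kphi vk)))); first exact: gS.
  by rewrite /= eq_s.
have [eq_b|neq_b] := eqVneq (i p) b; first by exists (g None); rewrite ?gS //= eq_b.
by exists (g (Some v)); rewrite ?gS //= eqxx.
Qed.

Lemma card_or_elt : #|or_elt| = N.+1 + (size phi + N * l * 2).
Proof.
by rewrite card_sum card_option card_sum !card_prod !card_ord card_bool.
Qed.

Lemma card_or_set : #|or_set| = 2 ^ l + 2 ^ l * N * 2.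
Proof. by rewrite card_sum !card_prod !card_ffun !card_ord !card_bool. Qed.
End OrCover.

(** * Covering by tuples *)

(** Pigeonhole: the most frequent value is taken at least the average number of times. *)
Lemma heavy_fiber (T Y : finType) (F : T -> Y) (A : {set T}) :
  0 < #|A| -> exists y, #|A| <= #|Y| * #|[set f in A | F f == y]|.
Proof.
case/card_gt0P=> f0 _; pose m y := #|[set f in A | F f == y]|.
case: (arg_maxnP (i0 := F f0) (P := xpredT) m) => // y _ y_max; exists y.
rewrite -sum1_card (partition_big F xpredT) //= -sum_nat_const.
apply: leq_sum => y' _; apply: leq_trans (y_max y' _) => //.
by rewrite sum1dep_card; apply/eq_leq/eq_card => f; rewrite !inE.
Qed.

(* Fortnow-Santhanam: some value [y] of [F] is taken by so many tuples that the
   components of these tuples make up at least half of [S]; iterate on the rest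
   of [S]. *)
Lemma tuple_cover (X I Y : finType) (F : {ffun I -> X} -> Y) (n : nat)
    (S : {set X}) :
  0 < #|I| -> #|Y| <= 2 ^ #|I| -> #|S| < 2 ^ n ->
  exists ys : seq Y, size ys <= n /\
    forall x, x \in S -> exists f : {ffun I -> X},
      [/\ forall i, f i \in S, F f \in ys & exists i, f i = x].
Proof.
move=> I_gt0 leY; elim: n S => [|n IHn] S ltS.
  exists [::]; split=> // x xS; move: ltS; rewrite ltnS leqn0 cards_eq0.
  by move/eqP=> S0; rewrite S0 inE in xS.
have [S0|/card_gt0P[x0 x0S]] := posnP #|S|.
  by exists [::]; split=> // x; rewrite (cards0_eq S0) inE.
pose A := [set f : {ffun I -> X} | f \in ffun_on (mem S)].
have cA : #|A| = #|S| ^ #|I| by rewrite cardsE card_ffun_on.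
have A_gt0 : 0 < #|A|.
  by rewrite cA expn_gt0; apply/orP; left; apply/card_gt0P; exists x0.
have [y leA] := heavy_fiber F A_gt0; set Ay := [set f in A | _] in leA.
pose C := [set x | [exists f in Ay, [exists i, f i == x]]].
have leAy : #|Ay| <= #|C| ^ #|I|.
  rewrite -card_ffun_on; apply: subset_leq_card; apply/subsetP=> f fA.
  apply/ffun_onP=> i; rewrite inE; apply/existsP; exists f.
  by rewrite fA; apply/existsP; exists i.
(* By [#|S| ^ #|I| = #|A| <= #|Y| * #|Ay| <= 2 ^ #|I| * #|C| ^ #|I|], taking roots. *)
have leSC : #|S| <= 2 * #|C|.
  rewrite -(leq_exp2r _ _ I_gt0) expnMn -cA (leq_trans leA) //.
  by rewrite leq_mul.
have subCS : C \subset S.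
  apply/subsetP=> x; rewrite inE => /existsP[f /andP[]]; rewrite inE => /andP[].
  by rewrite inE => /ffun_onP fS _ /existsP[i /eqP<-]; apply: fS.
have [|ys [size_ys cov_ys]] := IHn (S :\: C).
  rewrite cardsD (setIidPr subCS).
  by rewrite expnS in ltS; lia.
exists (y :: ys); split=> // x xS; have [xC|xC] := boolP (x \in C).
  move: xC; rewrite inE => /existsP[f /andP[fAy /existsP[i /eqP fi]]].
  move: fAy; rewrite !inE => /andP[/ffun_onP fS /eqP Ff].
  by exists f; rewrite inE Ff eqxx; split=> //; exists i.
have [|f [fS Ff fx]] := cov_ys x; first by rewrite inE xC.
exists f; split=> // [i|]; last by rewrite inE Ff orbT.
by have := fS i; rewrite inE => /andP[].
Qed.

(** * Computations as formulas *)

Lemma sat1 (V : Type) (rho : V -> bool) c : sat rho [:: c] = has (lit_holds rho) c.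
Proof. exact: andbT. Qed.

Lemma sat_cat (V : Type) (rho : V -> bool) (phi psi : cnf V) :
  sat rho (phi ++ psi) = sat rho phi && sat rho psi.
Proof. exact: all_cat. Qed.

Lemma sat_flatten (V : Type) (rho : V -> bool) (A : Type) (F : A -> cnf V) (s : seq A) :
  sat rho (flatten [seq F a | a <- s]) = all (fun a => sat rho (F a)) s.
Proof. by elim: s => //= a s <-; rewrite sat_cat. Qed.

Lemma cnf_size_cat (V : Type) (phi psi : cnf V) :
  cnf_size (phi ++ psi) = cnf_size phi + cnf_size psi.
Proof. by rewrite /cnf_size map_cat sumn_cat. Qed.

Lemma cnf_size_flatten (V A : Type) (F : A -> cnf V) (s : seq A) (b : nat) :
  (forall a, cnf_size (F a) <= b) ->
  cnf_size (flatten [seq F a | a <- s]) <= size s * b.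
Proof.
move=> leF; elim: s => //= a s IHs.
by rewrite cnf_size_cat mulSn leq_add.
Qed.

Lemma cnf_size_leq (V : eqType) (phi : cnf V) (b : nat) :
  (forall c, c \in phi -> size c < b) -> cnf_size phi <= size phi * b.
Proof.
elim: phi => //= c phi IHphi ltb; rewrite mulSn leq_add ?ltb ?mem_head //.
by apply: IHphi => c' c'phi; rewrite ltb // inE c'phi orbT.
Qed.

Definition horn (V : Type) (hyps : seq (V * bool)) (l : V * bool) : seq (V * bool) :=
  l :: [seq (h.1, ~~ h.2) | h <- hyps].

Lemma has_horn (V : Type) (rho : V -> bool) hyps l :
  has (lit_holds rho) (horn hyps l) =
  (all (lit_holds rho) hyps ==> lit_holds rho l).
Proof.
rewrite /= implybE orbC -has_predC has_map; congr (_ || _).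
by apply: eq_has => -[v b]; rewrite /= /lit_holds /=; case: (rho v) b => [] [].
Qed.

Lemma size_horn (V : Type) (hyps : seq (V * bool)) l : size (horn hyps l) = (size hyps).+1.
Proof. by rewrite /= size_map. Qed.

Lemma cnf_size_cons (V : Type) c (phi : cnf V) : cnf_size (c :: phi) = (size c).+1 + cnf_size phi.
Proof. by []. Qed.

Definition cell (M : tm) (t : tape M) (sd : bool) (j : nat) : tm_sym M :=
  nth None (if sd then t.2 else t.1) j.

(** Cells are addressed relative to the head, so that no fact has to record its position; instead a
    move shifts all cells. After writing [a] and moving by [d], a cell holds either [a] or the
    former content of the cell given here. *)
Definition cell_source (A : Type) (d : move) (a : A) (sd : bool) (j : nat) :
    A + bool * nat :=
  match d, sd, j with
  | MoveLeft, false, _ => inr (false, j.+1)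
  | MoveLeft, true, 0 => inr (false, 0)
  | MoveLeft, true, 1 => inl a
  | MoveLeft, true, j'.+1 => inr (true, j')
  | Stay, true, 0 => inl a
  | Stay, _, _ => inr (sd, j)
  | MoveRight, false, 0 => inl a
  | MoveRight, false, j'.+1 => inr (false, j')
  | MoveRight, true, _ => inr (true, j.+1)
  end.

Lemma cell_sourceP (M : tm) (d : move) (a : tm_sym M) (t : tape M) sd j :
  cell (tape_move d (tape_write a t)) sd j =
  match cell_source d a sd j with
  | inl a => a
  | inr (sd', j') => cell t sd' j'
  end.
Proof.
case: t => lt rt; rewrite /cell.
by case: d sd j => [] [] [|[|j]] //=; rewrite /tape_read /= ?nth_behead ?nth0.
Qed.

Lemma cell_source_leq (A : Type) (d : move) (a : A) sd j sd' j' :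
  cell_source d a sd j = inr (sd', j') -> j' <= j.+1.
Proof. by case: d sd j => [] [] [|[|j]] //= [_ <-] //; lia. Qed.

(** The minimal bit strings that are not prefixes of [z]. An output is a prefix of [z] if and only
    if it starts with none of them, which is expressed by clauses with negated facts only. *)
Fixpoint bad_outputs (z : seq bool) : seq (seq bool) :=
  if z is b :: z' then [:: ~~ b] :: map (cons b) (bad_outputs z')
  else [:: [:: true]; [:: false]].

Definition starts_with (A : finType) (r : seq (option (bool + A))) (p : seq bool) : bool :=
  all (fun j => nth None r j == Some (inl (nth false p j))) (iota 0 (size p)).

Lemma starts_with_cons (A : finType) (r : seq (option (bool + A))) b p :
  starts_with r (b :: p) = (head None r == Some (inl b)) && starts_with (behead r) p.
Proof.
rewrite /starts_with /= nth0 (iotaDl 1 0) all_map; congr (_ && _).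
by apply: eq_all => j /=; rewrite nth_behead.
Qed.

Lemma prefix_bad_outputs (A : finType) (r : seq (option (bool + A))) z :
  prefix (bits_prefix r) z = all (fun p => ~~ starts_with r p) (bad_outputs z).
Proof.
elim: z r => [|b z IHz] [|[[a|a]|] r] /=; rewrite ?starts_with_cons //=.
- by case: a; rewrite //= ?andbF.
- by apply/esym/allP=> _ /mapP[p _ ->]; rewrite starts_with_cons.
- have eq_bit (c d : bool) : (Some (inl c) == Some (inl d) :> option (bool + A)) = (c == d) by [].
  rewrite all_map eq_bit; have [<-|neq_ab] := eqVneq a b; last first.
    by rewrite /starts_with /=; case: a b neq_ab => [] [].
  have -> : (a == ~~ a) = false by case: (a).
  rewrite IHz /=; apply: eq_all => p.
  by rewrite /preim /= starts_with_cons /= eqxx.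
- by apply/esym/allP=> _ /mapP[p _ ->]; rewrite starts_with_cons.
- by apply/esym/allP=> _ /mapP[p _ ->]; rewrite starts_with_cons.
Qed.

Lemma size_bad_outputs z : size (bad_outputs z) = (size z).+2.
Proof. by elim: z => //= b z IHz; rewrite size_map IHz. Qed.

Lemma size_bad_output z p : p \in bad_outputs z -> size p <= (size z).+1.
Proof.
elim: z p => [|b z IHz] p /=; rewrite !inE; first by case/orP=> /eqP->.
by case/orP=> [/eqP-> //|/mapP[p' /IHz lep ->]].
Qed.

(** * The formula of a run *)

Section Tableau.
Variables (M : tm) (V : eqType) (T : nat) (tmpl : seq (entry V)) (z : seq bool).

Let tape_ix : finType := 'I_(tm_tapes M).+1.

(* At time [s] the facts about the cells at distance [j] from the heads are
   derivable if [j + s < window]. *)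
Let window : nat := T + (size z).+2.

(* [(s, inl q)]: the state at time [s] is [q];
   [(s, inr (i, sd, j, a))]: at time [s] tape [i] contains [a] in the [j]-th
   cell left of the head if [sd] is false, and in the [j]-th cell from the head
   on otherwise. *)
Definition run_fact : eqType := (nat * (tm_state M + tape_ix * bool * nat * tm_sym M))%type.

Definition run_var : eqType := (V + run_fact)%type.

Definition state_lit (s : nat) (q : tm_state M) : run_var * bool :=
  (inr (s, inl q), true).

Definition cell_lit (s : nat) (i : tape_ix) (sd : bool) (j : nat)
    (a : tm_sym M) : run_var * bool :=
  (inr (s, inr (i, sd, j, a)), true).

Definition init_cell (i : tape_ix) (sd : bool) (j : nat) : cnf run_var :=
  if (i == ord0) && sd && (j < size tmpl) then
    match nth (inl false) tmpl j with
    | inl b => [:: [:: cell_lit 0 i sd j (Some (inl b))]]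
    | inr (v, b) =>
        [:: horn [:: (inl v, b)] (cell_lit 0 i sd j (Some (inl true)));
            horn [:: (inl v, ~~ b)] (cell_lit 0 i sd j (Some (inl false)))]
    end
  else [:: [:: cell_lit 0 i sd j None]].

Definition for_cells (F : tape_ix -> bool -> nat -> cnf run_var) : cnf run_var :=
  flatten [seq flatten [seq flatten [seq F i sd j | j <- iota 0 window]
    | sd <- [:: false; true]] | i <- enum tape_ix].

Definition init_cnf : cnf run_var :=
  [:: state_lit 0 (tm_start M)] :: for_cells init_cell.

(** A halted machine rewrites the scanned symbols in place, so that its configuration has a
    transition like any other. *)
Definition next_action (q : tm_state M) (a : {ffun tape_ix -> tm_sym M}) :
    tm_state M * (tape_ix -> tm_sym M * move) :=
  if tm_halt q then (q, fun i => (a i, Stay)) else tm_delta q a.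

Definition head_lits (s : nat) (q : tm_state M) (a : {ffun tape_ix -> tm_sym M}) :
    seq (run_var * bool) :=
  state_lit s q :: [seq cell_lit s i true 0 (a i) | i <- enum tape_ix].

Definition step_cell (s : nat) (q : tm_state M) (a : {ffun tape_ix -> tm_sym M})
    (i : tape_ix) (sd : bool) (j : nat) : cnf run_var :=
  let act := (next_action q a).2 i in
  match cell_source act.2 act.1 sd j with
  | inl c => [:: horn (head_lits s q a) (cell_lit s.+1 i sd j c)]
  | inr (sd', j') =>
      [seq horn (cell_lit s i sd' j' c :: head_lits s q a) (cell_lit s.+1 i sd j c)
        | c <- enum (tm_sym M)]
  end.

Definition step_cnf (s : nat) (q : tm_state M) (a : {ffun tape_ix -> tm_sym M}) :
    cnf run_var :=
  horn (head_lits s q a) (state_lit s.+1 (next_action q a).1) ::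
  for_cells (step_cell s q a).

Definition output_cnf : cnf run_var :=
  [seq [seq ((cell_lit T ord0 true j (Some (inl (nth false p j)))).1, false)
    | j <- iota 0 (size p)] | p <- bad_outputs z].

(* All clauses that concern the run are Horn clauses deriving facts from facts,
   so that every satisfying assignment makes the facts of the actual run true;
   nothing has to be said about the other facts. *)
Definition run_cnf : cnf run_var :=
  init_cnf ++
  flatten [seq flatten [seq flatten [seq step_cnf s q a
    | a <- enum {ffun tape_ix -> tm_sym M}] | q <- enum (tm_state M)]
    | s <- iota 0 T] ++
  output_cnf.

Lemma sat_for_cells rho F :
  reflect (forall i sd j, j < window -> sat rho (F i sd j))
    (sat rho (for_cells F)).
Proof.
apply: (iffP idP) => [+ i sd j ltj|sat_F].
  rewrite sat_flatten => /allP/(_ i); rewrite mem_enum sat_flatten => /(_ isT).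
  move=> /allP/(_ sd); rewrite sat_flatten => /(_ _)/allP sat_F.
  by apply: sat_F; [case: (sd) | rewrite mem_iota].
rewrite sat_flatten; apply/allP=> i _; rewrite sat_flatten.
apply/allP=> sd _; rewrite sat_flatten; apply/allP=> j.
by rewrite mem_iota => /sat_F.
Qed.

(** Tapes are compared by their cells: in a halting state, rewriting a scanned blank may lengthen
    the list that represents the tape, but changes none of its cells. *)
Lemma next_action_step (c : config M) :
  let a := next_action c.1 [ffun i => tape_read (c.2 i)] in
  (tm_step c).1 = a.1 /\
  forall i sd j, cell ((tm_step c).2 i) sd j =
    cell (tape_move (a.2 i).2 (tape_write (a.2 i).1 (c.2 i))) sd j.
Proof.
rewrite /tm_step /next_action /=; case: ifP => //= _; split=> // i sd j.
by rewrite ffunE /cell; case: (c.2 i) sd j => lt [|a rt] [] [|j] //=; rewrite nth_nil.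
Qed.

Variable rho : V -> bool.

Let run (s : nat) : config M :=
  iter s (@tm_step M) (tm_init M [seq entry_val rho e | e <- tmpl]).

Let fact_holds (f : run_fact) : bool :=
  match f.2 with
  | inl q => (run f.1).1 == q
  | inr (i, sd, j, a) => cell ((run f.1).2 i) sd j == a
  end.

Let extend (rho' : run_fact -> bool) : run_var -> bool := sum_val rho rho'.

Lemma cell_run0 i sd j :
  cell ((run 0).2 i) sd j =
  if (i == ord0) && sd && (j < size tmpl)
  then Some (inl (entry_val rho (nth (inl false) tmpl j))) else None.
Proof.
rewrite /run /cell /=; case: eqP => _ /=; last by case: sd; rewrite nth_nil.
case: sd; last by rewrite nth_nil.
case: ltnP => [ltj|lej]; last by rewrite nth_default ?size_map.
by rewrite (nth_map false) ?size_map // (nth_map (inl false)).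
Qed.

Lemma head_lits_fact s q a :
  all (lit_holds (extend fact_holds)) (head_lits s q a) ->
  (run s).1 = q /\ [ffun i => tape_read ((run s).2 i)] = a.
Proof.
rewrite /= {1}/lit_holds /= /fact_holds /= eqb_id all_map => /andP[/eqP-> /allP ha].
split=> //; apply/ffunP=> i; rewrite ffunE; apply/eqP.
have := ha i; rewrite mem_enum => /(_ isT).
by rewrite /= /lit_holds /= /fact_holds /= eqb_id /cell nth0.
Qed.

Lemma run_cnf_complete :
  prefix (tm_output (run T)) z -> sat (extend fact_holds) run_cnf.
Proof.
move=> out_z; rewrite !sat_cat; apply/and3P; split.
- rewrite /= {1}/lit_holds /= /fact_holds /= eqxx /=.
  apply/sat_for_cells => i sd j _; rewrite /init_cell.
  have := cell_run0 i sd j; case: ifP => _ => [|eq_c]; last first.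
    by rewrite /= /lit_holds /= /fact_holds /= eq_c eqxx.
  case: nth => [b|[v b]] /= eq_c; rewrite /= /lit_holds /= /fact_holds /= eq_c ?eqxx //.
  by rewrite /lit_holds /=; case: (rho v) b {eq_c} => [] [].
- rewrite sat_flatten; apply/allP=> s _; rewrite sat_flatten; apply/allP=> q _.
  rewrite sat_flatten; apply/allP=> a _.
  have [/head_lits_fact[eq_q eq_a]|hyps] := boolP
      (all (lit_holds (extend fact_holds)) (head_lits s q a)); last first.
    apply/andP; split; first by rewrite has_horn (negbTE hyps).
    apply/sat_for_cells=> i sd j _; rewrite /step_cell.
    case: cell_source => [c|[sd' j']]; first by rewrite sat1 has_horn (negbTE hyps).
    by apply/allP=> _ /mapP[c _ ->]; rewrite has_horn -cat1s all_cat (negbTE hyps) andbF.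
  have [eq_q1 eq_c1] := next_action_step (run s); rewrite eq_q eq_a in eq_q1 eq_c1.
  apply/andP; split.
    rewrite has_horn; apply/implyP=> _.
    by rewrite /lit_holds /= /fact_holds /= eq_q1 eqxx.
  apply/sat_for_cells=> i sd j _; have := eq_c1 i sd j.
  rewrite cell_sourceP /step_cell; case: cell_source => [c|[sd' j']] eq_c.
    rewrite sat1 has_horn; apply/implyP=> _.
    by rewrite /lit_holds /= /fact_holds /= eq_c eqxx.
  apply/allP=> _ /mapP[c _ ->]; rewrite has_horn; apply/implyP=> /andP[].
  by rewrite /lit_holds /= /fact_holds /= eqb_id eq_c => -> _.
- apply/allP=> _ /mapP[p pz ->]; rewrite has_map.
  move: out_z; rewrite /tm_output prefix_bad_outputs => /allP/(_ p pz).
  rewrite -has_predC; apply: sub_has => j /=.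
  by rewrite /lit_holds /= /fact_holds /cell /= eqbF_neg.
Qed.

Lemma run_cnf_sound rho' :
  sat (extend rho') run_cnf -> prefix (tm_output (run T)) z.
Proof.
rewrite !sat_cat => /and3P[init_sat step_sat out_sat].
(* Unit propagation along the run. A cell depends on a cell at most one position farther from the
   head, so each step costs one cell of the window. *)
have facts s : s <= T -> rho' (s, inl (run s).1) /\
    forall i sd j, j + s < window ->
      rho' (s, inr (i, sd, j, cell ((run s).2 i) sd j)).
  elim: s => [_|s IHs lts].
    case/andP: init_sat => /=; rewrite orbF /lit_holds /= eqb_id => -> /sat_for_cells sat0.
    split=> // i sd j; rewrite addn0 => /(sat0 i sd); rewrite cell_run0 /init_cell.
    case: ifP => _; last by rewrite /= /lit_holds /= eqb_id orbF andbT.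
    case: nth => [b|[v b]] /=; first by rewrite /lit_holds /= eqb_id orbF andbT.
    by rewrite /lit_holds /= !eqb_id; case: (rho v); case: b; rewrite /= ?orbT ?orbF ?andbT.
  have [state_s cells_s] := IHs (ltnW lts).
  have {}step_sat q a : sat (extend rho') (step_cnf s q a).
    move: step_sat; rewrite sat_flatten => /allP/(_ s).
    rewrite mem_iota => /(_ lts); rewrite sat_flatten => /allP/(_ q).
    rewrite mem_enum => /(_ isT); rewrite sat_flatten => /allP/(_ a).
    by rewrite mem_enum => /(_ isT).
  have hyps : all (lit_holds (extend rho'))
      (head_lits s (run s).1 [ffun i => tape_read ((run s).2 i)]).
    rewrite /= {1}/lit_holds /= state_s /= all_map; apply/allP=> i _.
    rewrite /= /lit_holds /= ffunE /tape_read -nth0 eqb_id.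
    by apply: (cells_s i true 0); rewrite /window; lia.
  have /andP[sat_q /sat_for_cells sat_c] := step_sat (run s).1 [ffun i => tape_read ((run s).2 i)].
  have [eq_q1 eq_c1] := next_action_step (run s).
  split.
    move: sat_q; rewrite has_horn hyps /lit_holds /= eqb_id.
    by rewrite -eq_q1.
  move=> i sd j ltj; have := sat_c i sd j; rewrite (leq_trans _ ltj); last by lia.
  move=> /(_ isT); rewrite [run s.+1]/= -/(run s) eq_c1 cell_sourceP /step_cell.
  case eq_src: cell_source => [c|[sd' j']].
    by rewrite sat1 has_horn hyps /lit_holds /= eqb_id.
  move=> /allP sat_map; set c := cell _ sd' j'.
  pose F c0 := horn (cell_lit s i sd' j' c0 :: head_lits s (run s).1
    [ffun i => tape_read ((run s).2 i)]) (cell_lit s.+1 i sd j c0).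
  have := sat_map (F c) (map_f F (mem_enum _ c)).
  rewrite /F has_horn -cat1s all_cat hyps andbT all_seq1.
  rewrite /lit_holds /= !eqb_id cells_s //.
  by have := cell_source_leq eq_src; lia.
rewrite /tm_output prefix_bad_outputs; apply/allP=> p pz.
have /hasP[_ /mapP[j ltj ->]] := allP out_sat _ (map_f _ pz).
rewrite /lit_holds /= eqbF_neg => cell_p; apply/negP=> /allP/(_ j ltj) /eqP eq_j.
have [_ /(_ ord0 true j)] := facts T (leqnn T).
rewrite /cell eq_j (negbTE cell_p) => contra; suffices /contra : j + T < window by [].
rewrite /window addnC ltn_add2l ltnS; apply: leq_trans (size_bad_output pz).
by move: ltj; rewrite mem_iota => /ltnW.
Qed.

Lemma run_cnfP :
  (exists rho', sat (sum_val rho rho') run_cnf) <->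
  prefix (tm_output (run T)) z.
Proof.
by split=> [[rho' /run_cnf_sound]|/run_cnf_complete]; last exists fact_holds.
Qed.

(** It depends on the machine only. The formula is quadratic because the [T] steps each constrain
    [window] cells and the bad outputs have quadratic total length. *)
Definition run_cnf_const : nat :=
  2 + 2 * #|tape_ix| * 6 + #|{ffun tape_ix -> tm_sym M}| * #|tm_state M| *
    ((#|tape_ix| + 3) + 2 * #|tape_ix| * (#|tm_sym M| * (#|tape_ix| + 4))) + 2.

Lemma cnf_size_for_cells F b :
  (forall i sd j, cnf_size (F i sd j) <= b) ->
  cnf_size (for_cells F) <= 2 * #|tape_ix| * window * b.
Proof.
move=> leF; rewrite (_ : _ * b = size (enum tape_ix) * (2 * (window * b))); last first.
  by rewrite -cardE [RHS]mulnCA !mulnA.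
do 2!apply: cnf_size_flatten => ?.
by rewrite -{2}(size_iota 0 window); apply: cnf_size_flatten.
Qed.

Lemma run_cnf_size : cnf_size run_cnf <= run_cnf_const * (T + size z + 3) ^ 2.
Proof.
have le_init : cnf_size init_cnf <= 2 + 2 * #|tape_ix| * window * 6.
  apply: leq_add => //; apply: cnf_size_for_cells => i sd j.
  by rewrite /init_cell; case: ifP => // _; case: nth => [b|[v b]].
have size_hyps s q a : size (head_lits s q a) = #|tape_ix|.+1.
  by rewrite /= size_map -cardE.
have le_step s q a : cnf_size (step_cnf s q a) <=
    (#|tape_ix| + 3) + 2 * #|tape_ix| * window * (#|tm_sym M| * (#|tape_ix| + 4)).
  rewrite cnf_size_cons size_horn size_hyps; apply: leq_add; first by rewrite !addnS addn0.
  apply: cnf_size_for_cells => i sd j; rewrite /step_cell.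
  have sym_gt0 : 0 < #|tm_sym M| by rewrite card_option.
  case: cell_source => [c|[sd' j']].
    rewrite cnf_size_cons size_horn size_hyps addn0 -[X in X <= _]mul1n leq_mul //.
    by rewrite !addnS addn0 ltnS ltnW.
  rewrite [#|_|]cardE; elim: (enum _) => //= c e IHe.
  rewrite cnf_size_cons size_horn /= -/(head_lits s q a) mulSn leq_add //.
  by rewrite size_map -cardE !addnS addn0.
have le_out : cnf_size output_cnf <= (size z + 2) * (size z + 2).
  have := @cnf_size_leq _ output_cnf (size z + 2).
  rewrite size_map size_bad_outputs addn2; apply=> _ /mapP[p pz ->].
  by rewrite size_map size_iota ltnS size_bad_output.
rewrite !cnf_size_cat.
set X := cnf_size (flatten _).
have leX : X <= T * (#|tm_state M| * (#|{ffun tape_ix -> tm_sym M}| *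
   ((#|tape_ix| + 3) + 2 * #|tape_ix| * window * (#|tm_sym M| * (#|tape_ix| + 4))))).
  rewrite -{1}(size_iota 0 T); apply: cnf_size_flatten => s.
  rewrite cardE; apply: cnf_size_flatten => q.
  by rewrite [#|{: {ffun _}}|]cardE; apply: cnf_size_flatten => a.
apply: leq_trans (leq_add le_init (leq_add leX le_out)) _.
rewrite /run_cnf_const /window.
have -> : T + (size z).+2 = T + size z + 2 by lia.
move: (size z) (#|{: {ffun _}}|) (#|tape_ix|) (#|tm_state M|) (#|tm_sym M|) => y A B C D.
set w := T + y + 2; set S := T + y + 3.
pose P := A * C * (B + 3); pose Q := A * C * (2 * B * (D * (B + 4))).
have -> : 2 + 2 * B * w * 6 + (T * (C * (A * (B + 3 + 2 * B * w * (D * (B + 4))))) +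
    (y + 2) * (y + 2)) = 2 + 12 * B * w + (P * T + Q * (T * w)) + (y + 2) * (y + 2).
  by rewrite /P /Q; lia.
have -> : (2 + 2 * B * 6 + A * C * (B + 3 + 2 * B * (D * (B + 4))) + 2) * S ^ 2 =
    4 * S ^ 2 + 12 * B * S ^ 2 + (P * S ^ 2 + Q * S ^ 2).
  by rewrite /P /Q; move: (S ^ 2) => S2; lia.
have leS1 x : x <= S -> x <= S ^ 2 by rewrite -mulnn /S; nia.
have leS2 x1 x2 : x1 <= S -> x2 <= S -> x1 * x2 <= S ^ 2.
  by move=> le1 le2; rewrite -mulnn leq_mul.
have lew : w <= S by rewrite /w /S; lia.
have leT : T <= S by rewrite /S; lia.
have ley : y + 2 <= S by rewrite /S; lia.
have h1 := leq_mul (leqnn (12 * B)) (leS1 _ lew).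
have h2 := leq_mul (leqnn P) (leS1 _ leT).
have h3 := leq_mul (leqnn Q) (leS2 _ _ leT lew).
apply: leq_trans (leq_add (leq_add (leq_add (leqnn 2) h1) (leq_add h2 h3)) (leS2 _ _ ley ley)) _.
have : 0 < S ^ 2 by rewrite expn_gt0 /S addn3.
by move: (12 * B * S ^ 2) (P * S ^ 2) (Q * S ^ 2) (S ^ 2) => ? ? ? ?; lia.
Qed.
End Tableau.

Lemma size_bits_prefix (A : Type) (s : seq (option (bool + A))) :
  size (bits_prefix s) <= size s.
Proof. by elim: s => [|[[b|a]|] s IHs]. Qed.

Lemma size_tm_output (M : tm) (x : seq bool) (t : nat) :
  size (tm_output (iter t (@tm_step M) (tm_init M x))) <= size x + t.+1.
Proof.
apply: leq_trans (size_bits_prefix _) _.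
rewrite addnS; elim: t => [|t IHt]; first by rewrite /= size_map addn0.
rewrite iterS addnS; set c := iter t _ _ in IHt *; rewrite /tm_step.
case: ifP => _; first exact: ltnW.
have grow d a : size (tape_move d (tape_write a (c.2 ord0))).2 <= (size (c.2 ord0).2).-1.+2.
  by case: d => /=; rewrite ?size_behead // ltnW.
by apply: leq_trans (grow _ _) _; rewrite !ltnS -subn1 leq_subLR.
Qed.

Lemma sat_cons (V : Type) (rho : V -> bool) c phi :
  sat rho (c :: phi) = has (lit_holds rho) c && sat rho phi.
Proof. by []. Qed.

(** * Disjunction of formulas and renaming of variables *)

Section OrCnf.
Variables (V A : eqType) (s : seq A) (F : A -> cnf V).

Definition guard (a : A) (c : seq (V * bool)) : seq ((V + A) * bool) :=
  (inr a, false) :: [seq (inl x.1, x.2) | x <- c].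

(** The variables in [A] are selectors: one of them must be true, and the clauses of [F a] are
    enforced only if [a] is selected. *)
Definition or_cnf : cnf (V + A) :=
  [seq (inr a, true) | a <- s] :: flatten [seq map (guard a) (F a) | a <- s].

Lemma or_cnfP (rho : V -> bool) :
  (exists sel, sat (sum_val rho sel) or_cnf) <->
  exists2 a, a \in s & sat rho (F a).
Proof.
split=> [[sel]|[a0 a0s sat_a0]].
  rewrite sat_cons => /andP[]; rewrite has_map => /hasP[a a_s].
  rewrite /lit_holds /= eqb_id => sel_a.
  rewrite sat_flatten => /allP/(_ a a_s) sat_a; exists a => //.
  move: sat_a; rewrite /sat all_map; apply: sub_all => c.
  by rewrite /= /lit_holds /= sel_a has_map.
exists (pred1 a0); rewrite sat_cons; apply/andP; split.
  by rewrite has_map; apply/hasP; exists a0; rewrite //= /lit_holds /= eqxx.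
rewrite sat_flatten; apply/allP=> a _; rewrite /sat all_map.
have [->|/negbTE neq_a] := eqVneq a a0; last first.
  by apply/allP=> c _; rewrite /= /lit_holds /= neq_a.
by apply: sub_all sat_a0 => c; rewrite /= has_map => ->; rewrite orbT.
Qed.

Lemma or_cnf_size b :
  (forall a, a \in s -> cnf_size (F a) <= b) ->
  cnf_size or_cnf <= 1 + size s + size s * (2 * b).
Proof.
move=> leF; rewrite cnf_size_cons size_map add1n leq_add //.
have guard_size a : cnf_size (map (guard a) (F a)) <= 2 * cnf_size (F a).
  elim: (F a) => //= c phi IHphi; rewrite !cnf_size_cons mulnDr leq_add //=.
  by rewrite size_map; lia.
elim: s leF => //= a s' IHs leF; rewrite cnf_size_cat mulSn leq_add //.
  by apply: leq_trans (guard_size a) _; rewrite leq_mul ?leF ?mem_head.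
by apply: IHs => a' a's; rewrite leF // inE a's orbT.
Qed.
End OrCnf.

(** A variable is numbered by its first position in the list of the [n] inputs followed by all
    occurrences in [phi]. Thus the inputs get the numbers below [n], and the length of the list
    bounds all numbers. *)
Lemma cnf_rename (V : eqType) (inp : nat -> V) (n : nat) (phi : cnf V) :
  injective inp ->
  exists psi : cnf nat,
    [/\ cnf_size psi = cnf_size phi,
        forall c x, c \in psi -> x \in c -> x.1 < n + cnf_size phi
      & forall b : nat -> bool,
        (exists rho, (forall j, j < n -> rho (inp j) = b j) /\ sat rho phi) <->
        (exists rho, (forall j, j < n -> rho j = b j) /\ sat rho psi)].
Proof.
move=> inp_inj; pose vs := map inp (iota 0 n) ++ map fst (flatten phi).
pose f (x : V * bool) := (index x.1 vs, x.2).
have f_inp j : j < n -> index (inp j) vs = j.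
  move=> ltjn; rewrite index_cat map_f ?mem_iota // index_map //.
  have <- : nth 0 (iota 0 n) j = j by rewrite nth_iota.
  by rewrite index_uniq ?iota_uniq ?size_iota // nth_iota.
exists (map (map f) phi); split.
- by rewrite /cnf_size -map_comp; congr sumn; apply: eq_map => c; rewrite /= size_map.
- move=> _ _ /mapP[c cphi ->] /mapP[x xc ->] /=.
  have xvs : x.1 \in vs.
    by rewrite mem_cat map_f ?orbT //; apply/flattenP; exists c.
  rewrite -index_mem in xvs; apply: leq_trans xvs _.
  rewrite size_cat !size_map size_iota leq_add2l size_flatten /shape.
  by elim: (phi) => //= d e IH; rewrite cnf_size_cons leq_add.
move=> b; split=> [[rho [rho_in sat_phi]]|[rho [rho_in sat_psi]]].
  exists (fun j => rho (nth (inp 0) vs j)); split=> [j ltjn|].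
    by rewrite -{1}(f_inp j ltjn) nth_index ?rho_in // mem_cat map_f // mem_iota.
  rewrite /sat all_map; apply/allP=> c cphi; rewrite /= has_map.
  have /hasP[x xc xh] := allP sat_phi c cphi; apply/hasP; exists x => //.
  rewrite /lit_holds /= nth_index //.
  by rewrite mem_cat map_f ?orbT //; apply/flattenP; exists c.
exists (fun v => rho (index v vs)); split=> [j ltjn|].
  by rewrite f_inp ?rho_in.
move: sat_psi; rewrite /sat all_map; apply: sub_all => c /=.
by rewrite has_map.
Qed.

(** The first [n] variables are the input bits, the others are existential. The bound [s] also
    applies to the numbers of the variables, because the advice will write them in unary. *)
Definition cnf_represents (n s : nat) (P : seq bool -> Prop) : Prop :=
  exists phi : cnf nat,
    [/\ cnf_size phi <= s,
        forall c x, c \in phi -> x \in c -> x.1 < s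
      & forall x, size x = n ->
        P x <-> exists rho, (forall j, j < n -> rho j = nth false x j) /\ sat rho phi].

Definition poly_cnf (L : language) : Prop :=
  exists q : {poly nat}, forall n, cnf_represents n q.[n]%R L.

(** * Polynomial bounds *)

Lemma hornerE_nat (q : {poly nat}) (n : nat) :
  q.[n]%R = \sum_(i < size q) nth 0 q i * n ^ i.
Proof.
rewrite horner_coef; apply: eq_bigr => i _.
by congr (_ * _); elim: (nat_of_ord i) => //= k IHk; rewrite exprS IHk expnS.
Qed.

Lemma horner_mono (q : {poly nat}) (m n : nat) : m <= n -> q.[m]%R <= q.[n]%R.
Proof.
move=> lemn; rewrite !hornerE_nat; apply: leq_sum => i _.
by rewrite leq_mul //; case: (nat_of_ord i) => // k; rewrite leq_exp2r.
Qed.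

Definition pbounded (f : nat -> nat) : Prop :=
  exists q : {poly nat}, forall n, f n <= q.[n]%R.

Lemma pbounded_leq f g : (forall n, f n <= g n) -> pbounded g -> pbounded f.
Proof. by move=> lefg [q gq]; exists q => n; apply: leq_trans (gq n). Qed.

Lemma pbounded_const c : pbounded (fun=> c).
Proof. by exists (c%:P)%R => n; rewrite hornerC. Qed.

Lemma pbounded_id : pbounded id.
Proof. by exists 'X%R => n; rewrite hornerX. Qed.

Lemma pbounded_add f g : pbounded f -> pbounded g -> pbounded (fun n => f n + g n).
Proof. by move=> [p fp] [q gq]; exists (p + q)%R => n; rewrite hornerD leq_add. Qed.

Lemma pbounded_succ f : pbounded f -> pbounded (fun n => (f n).+1).
Proof.
by move=> /(pbounded_add (pbounded_const 1)); apply: pbounded_leq => n; rewrite add1n.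
Qed.

Lemma pbounded_mul f g : pbounded f -> pbounded g -> pbounded (fun n => f n * g n).
Proof. by move=> [p fp] [q gq]; exists (p * q)%R => n; rewrite hornerM leq_mul. Qed.

Lemma pbounded_exp f k : pbounded f -> pbounded (fun n => f n ^ k).
Proof.
move=> pf; elim: k => [|k IHk]; first exact: pbounded_const.
by apply: pbounded_leq (pbounded_mul pf IHk) => n; rewrite expnS.
Qed.

Lemma pbounded_horner (q : {poly nat}) f : pbounded f -> pbounded (fun n => q.[f n]%R).
Proof.
move=> [p fp]; exists (q \Po p)%R => n.
by rewrite horner_comp horner_mono.
Qed.

Ltac pbound := repeat match goal with
  | |- pbounded (fun _ => _ + _) => apply: pbounded_add
  | |- pbounded (fun _ => _ * _) => apply: pbounded_mul
  | |- pbounded (fun _ => _ ^ _) => apply: pbounded_exp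
  | |- pbounded (fun n => n) => exact: pbounded_id
  | |- pbounded (fun n => horner _ _) => apply: pbounded_horner
  | |- pbounded (horner ?q) => apply: (pbounded_horner q pbounded_id)
  | |- pbounded (fun _ => _.+1) => apply: pbounded_succ
  | |- pbounded S => apply: (pbounded_succ pbounded_id)
  | |- pbounded (addn ?c) => apply: (@pbounded_add (fun=> c) id)
  | |- pbounded (muln ?c) => apply: (@pbounded_mul (fun=> c) id)
  | |- pbounded id => exact: pbounded_id
  | |- pbounded _ => first [assumption | exact: pbounded_const]
  end.

(** * A machine that evaluates formulas *)

(** [Parse] and [Copy] bring the first component of the input pair to the second tape; [Op0], [Op1]
    and [Op2] collect the bits of an instruction and carry the flag; [Skip] and [Check] alternate
    over the marked bits of the input; [Answer] and [Write] produce the output. *)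
Inductive ev_state :=
  Parse | Copy | Op0 of bool | Op1 of bool & bool | Op2 of bool & bool & bool
| Skip | Check | Answer of bool | Write of bool | Halt.

Definition ev_code (s : ev_state) : 'I_10 * bool * bool * bool :=
  match s with
  | Parse => (@Ordinal 10 0 isT, false, false, false)
  | Copy => (@Ordinal 10 1 isT, false, false, false)
  | Op0 f => (@Ordinal 10 2 isT, f, false, false)
  | Op1 f b => (@Ordinal 10 3 isT, f, b, false)
  | Op2 f b c => (@Ordinal 10 4 isT, f, b, c)
  | Skip => (@Ordinal 10 5 isT, false, false, false)
  | Check => (@Ordinal 10 6 isT, false, false, false)
  | Answer b => (@Ordinal 10 7 isT, b, false, false)
  | Write b => (@Ordinal 10 8 isT, b, false, false)
  | Halt => (@Ordinal 10 9 isT, false, false, false)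
  end.

Definition ev_decode (x : 'I_10 * bool * bool * bool) : ev_state :=
  let: (i, f, b, c) := x in
  match nat_of_ord i with
  | 0 => Parse | 1 => Copy | 2 => Op0 f | 3 => Op1 f b | 4 => Op2 f b c
  | 5 => Skip | 6 => Check | 7 => Answer f | 8 => Write f | _ => Halt
  end.

Lemma ev_codeK : cancel ev_code ev_decode.
Proof. by case. Qed.

HB.instance Definition _ := Finite.copy ev_state (can_type ev_codeK).

(* The advice, read backwards, is a program with instructions of three bits:
   move the head of the certificate tape right (000) or left (001), set the
   flag [f] if the scanned bit is [s] (01s), reject unless [f] is set and reset
   it (10x), and leave the program for the comparison of the input with the
   certificate (11x). *)
Definition ev_op (s : ev_state) (b bit : bool) : ev_state * move :=
  match s with
  | Op0 f => (Op1 f b, Stay)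
  | Op1 f b1 => (Op2 f b1 b, Stay)
  | Op2 f false false => (Op0 f, if b then MoveLeft else MoveRight)
  | Op2 f false true => (Op0 (f || (bit == b)), Stay)
  | Op2 f true false => (if f then Op0 false else Answer false, Stay)
  | Op2 f true true => (Skip, Stay)
  | Skip => (Check, MoveLeft)
  | Check => (if bit == b then Skip else Answer false, Stay)
  | _ => (s, Stay)
  end.

Definition ev_end (s : ev_state) : bool :=
  match s with Skip | Check => true | Answer b => b | _ => false end.

Definition ev_sym : finType := option (bool + void).

Definition on_tapes (A : Type) (x y : A) (i : 'I_2) : A := if i == ord0 then x else y.

Definition ev_delta (s : ev_state) (a : {ffun 'I_2 -> ev_sym}) :
    ev_state * ('I_2 -> ev_sym * move) :=
  let a0 := a ord0 in let a1 := a ord_max in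
  match s with
  | Parse =>
      if a0 is Some (inl false)
      then (Op0 false, on_tapes (a0, MoveRight) (a1, MoveLeft))
      else (Copy, on_tapes (a0, MoveRight) (a1, Stay))
  | Copy => (Parse, on_tapes (a0, MoveRight) (a0, MoveRight))
  | Answer b => (Write b, on_tapes (None, MoveLeft) (a1, Stay))
  | Write b => (Halt, on_tapes (Some (inl b), Stay) (a1, Stay))
  | Halt => (Halt, on_tapes (a0, Stay) (a1, Stay))
  | _ =>
      if a1 is Some (inl b) then
        let r := ev_op s b (a0 == Some (inl true)) in
        (r.1, on_tapes (a0, r.2) (a1, MoveLeft))
      else (Answer (ev_end s), on_tapes (a0, Stay) (a1, Stay))
  end.

Definition ev_halt (s : ev_state) : bool := if s is Halt then true else false.

Definition ev_tm : tm := @TM 1 void ev_state Parse ev_halt ev_delta.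

Definition ev_tape : Type := tape ev_tm.

Definition bits (s : seq bool) : seq ev_sym := [seq Some (inl b) | b <- s].

Definition shift (d : move) (t : ev_tape) : ev_tape :=
  @tape_move ev_tm d (@tape_write ev_tm (@tape_read ev_tm t) t).

Definition scan (t : ev_tape) : bool := @tape_read ev_tm t == Some (inl true).

(** The run after parsing, with the second tape replaced by the list of the bits still to be
    read. *)
Fixpoint ev_exec (s : ev_state) (p : seq bool) (t : ev_tape) : bool :=
  if p is b :: p' then
    let r := ev_op s b (scan t) in ev_exec r.1 p' (shift r.2 t)
  else ev_end s.

Lemma ev_exec_answer b p t : ev_exec (Answer b) p t = b.
Proof. by elim: p t => /=. Qed.

Definition certificate_tape (wu : seq bool * seq bool) : ev_tape :=
  (rev (bits (rcons (flatten [seq [:: true; b] | b <- wu.1]) false)), bits wu.2).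

Definition ev_verdict (wu : seq bool * seq bool) : bool :=
  ev_exec (Op0 false) (rev wu.1) (certificate_tape wu).

Definition ev_running (s : ev_state) : bool :=
  match s with Parse | Copy | Write _ | Halt => false | _ => true end.

Lemma ev_op_running s b bit : ev_running s -> ev_running (ev_op s b bit).1.
Proof. by case: s => [||f|f b1|f [] []|||b'|b'|] //=; case: ifP. Qed.

Notation ev_step := (@tm_step ev_tm).

(** [Answer] leaves a blank behind and moves left, so the output ends after the single bit that
    [Write] puts there. *)
Lemma ev_answer_halts (c : config ev_tm) (b : bool) :
  c.1 = Answer b ->
  let c' := iter 2 ev_step c in tm_halt c'.1 /\ tm_output c' = [:: b].
Proof. by case: c => s t /= ->. Qed.

Lemma ev_step_op (c : config ev_tm) (b : bool) (p : seq bool) :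
  let r := ev_op c.1 b (scan (c.2 ord0)) in
  ev_running c.1 -> (if c.1 is Answer _ then false else true) ->
  @tape_read ev_tm (c.2 ord_max) = Some (inl b) ->
  (c.2 ord_max).1 = bits p ->
  [/\ (ev_step c).1 = r.1, (ev_step c).2 ord0 = shift r.2 (c.2 ord0),
      @tape_read ev_tm ((ev_step c).2 ord_max) = head None (bits p)
    & ((ev_step c).2 ord_max).1 = behead (bits p)].
Proof.
case: c => s t /= run_s op_s read_t left_t.
by case: s run_s op_s => //= [f|f b1|f b1 b2||] _ _;
  rewrite /tm_step /= /ev_delta !ffunE read_t /= -/(scan _) left_t.
Qed.

Lemma ev_step_end (c : config ev_tm) :
  ev_running c.1 -> (if c.1 is Answer _ then false else true) ->
  @tape_read ev_tm (c.2 ord_max) = None ->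
  (ev_step c).1 = Answer (ev_end c.1).
Proof.
case: c => s t /= run_s op_s read_t.
by case: s run_s op_s => //= [f|f b1|f b1 b2||] _ _;
  rewrite /tm_step /= /ev_delta !ffunE read_t.
Qed.

(** At most one step per bit of [p], one step to notice the end and two for the answer. *)
Lemma ev_exec_halts (c : config ev_tm) (p : seq bool) :
  ev_running c.1 -> @tape_read ev_tm (c.2 ord_max) = head None (bits p) ->
  (c.2 ord_max).1 = behead (bits p) ->
  exists2 k, k <= size p + 3 & let c' := iter k ev_step c in
    tm_halt c'.1 /\ tm_output c' = [:: ev_exec c.1 p (c.2 ord0)].
Proof.
have answer c0 b p0 : c0.1 = Answer b -> exists2 k, k <= size p0 + 3 &
    let c' := iter k ev_step c0 in
    tm_halt c'.1 /\ tm_output c' = [:: ev_exec c0.1 p0 (c0.2 ord0)].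
  move=> eq_b; exists 2; first by rewrite addnC.
  by rewrite eq_b ev_exec_answer; apply: ev_answer_halts.
elim: p c => [|b p IHp] c run_c read_c left_c;
  have [op_c|] := boolP (if c.1 is Answer _ then false else true);
  try by case: (c.1) (answer c) => // b0 h _; apply: h.
  have := ev_step_end run_c op_c read_c; move/ev_answer_halts => halts.
  by exists 3 => //; rewrite iterSr.
have [eq1 eq0 read1 left1] := ev_step_op run_c op_c read_c left_c.
have [|k lek [halts out]] := IHp (ev_step c) _ read1 left1.
  by rewrite eq1 ev_op_running.
exists k.+1; first by rewrite ltnS.
by rewrite /= -[ev_step _]iterS iterSr out eq1 eq0.
Qed.

Lemma ev_step_copy (c : config ev_tm) (b : bool) r l acc :
  c.1 = Parse -> c.2 ord0 = (l, [:: Some (inl true), Some (inl b) & r]) ->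
  c.2 ord_max = (acc, [::]) ->
  let c' := iter 2 ev_step c in
  [/\ c'.1 = Parse, c'.2 ord0 = ([:: Some (inl b), Some (inl true) & l], r)
    & c'.2 ord_max = (Some (inl b) :: acc, [::])].
Proof.
case: c => s t /= -> t0 t1; set c1 := ev_step (Parse, t).
have s1 : c1.1 = Copy by rewrite /c1 /tm_step /= /ev_delta !ffunE t0.
have t10 : c1.2 ord0 = (Some (inl true) :: l, Some (inl b) :: r).
  by rewrite /c1 /tm_step /= /ev_delta !ffunE t0 /= ?t0.
have t11 : c1.2 ord_max = (acc, [:: None]).
  by rewrite /c1 /tm_step /= /ev_delta !ffunE t0 /= ?t1.
move: c1 s1 t10 t11 => [s1 t'] /= -> t10 t11.
by rewrite /tm_step /= /ev_delta !ffunE t10 t11.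
Qed.

Lemma ev_parse (w u : seq bool) (c : config ev_tm) l acc :
  c.1 = Parse ->
  c.2 ord0 = (l, bits (code_pair (w, u))) -> c.2 ord_max = (acc, [::]) ->
  let c' := iter (2 * size w).+1 ev_step c in
  let stack := rev (bits w) ++ acc in
  [/\ c'.1 = Op0 false,
      c'.2 ord0 = (rev (bits (rcons (flatten [seq [:: true; b] | b <- w]) false)) ++ l, bits u)
    & c'.2 ord_max = (behead stack, [:: head None stack; None])].
Proof.
elim: w c l acc => [|b w IHw] c l acc.
  case: c => s t /= -> t0 t1; rewrite /tm_step /= /ev_delta !ffunE t0 t1 /=.
  by split.
move=> c_parse t0 t1; rewrite (_ : (2 * _).+1 = (2 * size w).+1 + 2); last first.
  by rewrite /=; lia.
have [s2 t20 t21] := ev_step_copy c_parse t0 t1.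
rewrite iterD => c' stack; rewrite /c' /stack {c' stack}.
have [-> -> ->] := IHw _ _ _ s2 t20 t21.
by rewrite /= !rev_cons !cat_rcons.
Qed.

Lemma ev_poly_time : poly_time code_pair code_bool ev_verdict.
Proof.
(* Parsing takes [2 * size w + 1] steps and the program at most [size w + 3], while the code of the
   pair has at least [2 * size w + 1] bits. *)
exists ev_tm, ('X + 'X + 5%:P)%R => -[w u]; rewrite !hornerD hornerX hornerC.
have [|||eq_s eq0 eq1] := @ev_parse w u (tm_init ev_tm (code_pair (w, u))) [::] [::] => //.
set c := iter _ _ _ in eq_s eq0 eq1.
have [|||k lek [halts out]] := @ev_exec_halts c (rev w).
- by rewrite eq_s.
- by rewrite eq1 cats0 /bits map_rev.
- by rewrite eq1 cats0 /bits map_rev.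
rewrite /tm_computes; set n := (_ + _)%R.
have eq_n : n = n - (k + (2 * size w).+1) + (k + (2 * size w).+1).
  rewrite subnK // /n.
  rewrite size_code_pair.
  rewrite size_rev in lek.
  by rewrite -[X in _ <= X]/(_ + _ + 5)%N; move: lek; lia.
rewrite eq_n.
rewrite iterD [iter (k + _) _ _]iterD -/c.
have stay m : iter m ev_step (iter k ev_step c) = iter k ev_step c.
  by elim: m => //= m ->; rewrite {1}/tm_step halts.
by rewrite stay out /ev_verdict /code_bool /= eq_s eq0 cats0.
Qed.

(** * Programs that check a formula against a certificate *)

Section Program.
Variable u : seq bool.

(** The head is on bit [h] of [u]. The tape is described by its cells, as moves may append blanks;
    on the left only the [h] nearest cells are specified. *)
Definition at_pos (h : nat) (t : ev_tape) : Prop :=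
  (forall j, nth None t.2 j = nth None (bits u) (h + j)) /\
  (forall j, j < h -> nth None t.1 j = nth None (bits u) (h.-1 - j)).

Lemma at_pos_stay h t : at_pos h t -> at_pos h (shift Stay t).
Proof.
case: t => l r [posr posl]; split=> [[|j]|j] //=.
- by rewrite -posr /tape_read /= nth0.
- by rewrite nth_behead posr.
- exact: posl.
Qed.

Lemma at_pos_right h t : at_pos h t -> at_pos h.+1 (shift MoveRight t).
Proof.
case: t => l r [posr posl]; split=> [j|[|j]] /=.
- by rewrite nth_behead posr addSnnS.
- by rewrite subn0 -[h]addn0 -posr /tape_read nth0.
- by rewrite ltnS => ltj; rewrite posl // -subn1 -subnDA add1n.
Qed.

Lemma at_pos_left h t : at_pos h.+1 t -> at_pos h (shift MoveLeft t).
Proof.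
case: t => l r [posr posl]; split=> [[|[|j]]|j ltj] /=.
- by rewrite -nth0 posl ?subn0 ?addn0.
- by rewrite /tape_read -nth0 posr addn0 addn1.
- by rewrite nth_behead posr addSnnS.
- by rewrite nth_behead posl // subnS -subn1 subnAC subn1.
Qed.

Lemma at_pos_scan h t : at_pos h t -> scan t = nth false u h.
Proof.
case=> posr _; rewrite /scan /tape_read -nth0 posr addn0 /bits.
have [ltn|len] := ltnP h (size u); last by rewrite !nth_default ?size_map.
by rewrite (nth_map false) //; case: nth.
Qed.

Lemma at_pos_start (w : seq bool) : at_pos 0 (certificate_tape (w, u)).
Proof. by []. Qed.

(** A Hoare triple for the piece [p] of a program, stated for every continuation [p'] so that pieces
    compose. *)
Definition leads (h : nat) (f : bool) (p : seq bool) (h' : nat) (f' : bool) : Prop :=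
  forall p' t, at_pos h t ->
    exists2 t', at_pos h' t' & ev_exec (Op0 f) (p ++ p') t = ev_exec (Op0 f') p' t'.

Lemma leads_cat h1 f1 p1 h2 f2 p2 h3 f3 :
  leads h1 f1 p1 h2 f2 -> leads h2 f2 p2 h3 f3 -> leads h1 f1 (p1 ++ p2) h3 f3.
Proof.
move=> lead1 lead2 p t /(lead1 (p2 ++ p))[t1 /(lead2 p)[t2 pos2 eq2] eq1].
by exists t2; rewrite -?catA ?eq1.
Qed.

Lemma leads_nil h f : leads h f [::] h f.
Proof. by move=> p t pos; exists t. Qed.

Definition move_code (n : nat) (left : bool) : seq bool :=
  flatten (nseq n [:: false; false; left]).

Lemma leads_right n h f : leads h f (move_code n false) (n + h) f.
Proof.
elim: n h => [|n IHn] h; first exact: leads_nil.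
rewrite addSnnS; apply: leads_cat (IHn h.+1) => p t pos.
by eexists; last by []; apply/at_pos_right/at_pos_stay/at_pos_stay.
Qed.

Lemma leads_left n h f : leads (n + h) f (move_code n true) h f.
Proof.
elim: n h => [|n IHn] h; first exact: leads_nil.
apply: leads_cat (IHn h) => p t pos.
by eexists; last by []; apply/at_pos_left/at_pos_stay/at_pos_stay.
Qed.

Definition lit_code (x : nat * bool) : seq bool :=
  move_code x.1 false ++ [:: false; true; x.2] ++ move_code x.1 true.

Lemma leads_lit f x : leads 0 f (lit_code x) 0 (f || lit_holds (nth false u) x).
Proof.
case: x => v s; apply: leads_cat; first exact: leads_right.
apply: leads_cat; last exact: leads_left.
move=> p t /at_pos_stay/at_pos_stay pos; eexists; first exact: at_pos_stay pos.
by rewrite /= (at_pos_scan pos) addn0.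
Qed.

Lemma leads_lits f c :
  leads 0 f (flatten (map lit_code c)) 0 (f || has (lit_holds (nth false u)) c).
Proof.
elim: c f => [|x c IHc] f; first by rewrite orbF; apply: leads_nil.
by rewrite /= orbA; apply: leads_cat (leads_lit f x) (IHc _).
Qed.

Definition clause_code (c : seq (nat * bool)) : seq bool :=
  flatten (map lit_code c) ++ [:: true; false; false].

Lemma exec_clauses phi p t : at_pos 0 t ->
  exists2 t', at_pos 0 t' &
    ev_exec (Op0 false) (flatten (map clause_code phi) ++ p) t =
    sat (nth false u) phi && ev_exec (Op0 false) p t'.
Proof.
elim: phi t => [|c phi IHphi] t pos; first by exists t.
rewrite /= -!catA; set p' := flatten _ ++ p.
have [t1 pos1 ->] := leads_lits false c ([:: true; false; false] ++ p') pos.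
pose t2 := shift Stay (shift Stay (shift Stay t1)).
have pos2 : at_pos 0 t2 by do 3!apply: at_pos_stay.
case: has; last by exists t2; rewrite //= ev_exec_answer.
by have [t3 pos3 eq3] := IHphi t2 pos2; exists t3.
Qed.

(** Both words are compared from their ends, so the head starts just behind the first [size x] bits
    of [u]. The bit [b], which [Skip] consumes, is the end mark of the pair at first and the mark of
    a bit afterwards. *)
Lemma exec_check (x : seq bool) (b : bool) t :
  at_pos (size x) t ->
  ev_exec Skip (b :: rev (flatten [seq [:: true; b] | b <- x])) t =
  (x == mkseq (nth false u) (size x)).
Proof.
elim/last_ind: x b t => [|x c IHx] b t pos //.
rewrite map_rcons flatten_rcons rev_cat size_rcons in pos *.
rewrite /mkseq -addn1 iotaD map_cat /= cats1 eqseq_rcons.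
have pos1 := at_pos_left pos; have pos2 := at_pos_stay pos1.
rewrite -/(shift MoveLeft t) (at_pos_scan pos1) eq_sym.
case: eqP => _; last by rewrite ev_exec_answer andbF.
by rewrite andbT; apply: (IHx true _ pos2).
Qed.
End Program.

(** The walk by [N] positions and back makes the program so long that a certificate of [N] bits is
    no longer than the verified input. The last walk reaches the position at which the comparison
    with the input begins. *)
Definition program (n N : nat) (phi : cnf nat) : seq bool :=
  move_code N false ++ move_code N true ++ flatten (map clause_code phi) ++
  move_code n false ++ [:: true; true; true].

Lemma verdict_program (n N : nat) (phi : cnf nat) (x u : seq bool) :
  size x = n ->
  ev_verdict (code_pair (x, rev (program n N phi)), u) =
  sat (nth false u) phi && (x == mkseq (nth false u) n).
Proof.
move=> <-; rewrite /ev_verdict /code_pair /= rev_cat rev_cons revK.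
rewrite -cats1 -catA /program -!catA.
set t := certificate_tape _; have pos0 : at_pos u 0 t by apply: at_pos_start.
set p4 := [:: false] ++ _; set p3 := move_code (size x) false ++ _; set p2 := flatten _ ++ _.
have skip : leads u 0 false (move_code N false ++ move_code N true) 0 false.
  by apply: leads_cat (@leads_right u N 0 false) (@leads_left u N 0 false).
rewrite catA; have [t2 pos2 ->] := skip p2 t pos0.
have [t3 pos3 ->] := exec_clauses phi p3 pos2; congr (_ && _).
have [t4 pos4 ->] := @leads_right u (size x) 0 false ([:: true; true; true] ++ p4) _ pos3.
rewrite addn0 in pos4.
apply: exec_check.
by do 3!apply: at_pos_stay.
Qed.

Lemma size_move_code k left : size (move_code k left) = 3 * k.
Proof. by elim: k => //= k IHk; rewrite mulnS -IHk. Qed.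

Lemma size_program (n N : nat) (phi : cnf nat) :
  (forall c x, c \in phi -> x \in c -> x.1 < N) ->
  size (program n N phi) <= 6 * N + cnf_size phi * (6 * N + 3) + 3 * n + 3.
Proof.
move=> ltN; rewrite /program !size_cat !size_move_code /=.
suffices: size (flatten (map clause_code phi)) <= cnf_size phi * (6 * N + 3) by lia.
elim: phi ltN => //= c phi IHphi ltN; rewrite size_cat cnf_size_cons mulnDl.
apply: leq_add; last by apply: IHphi => c' x c'phi; apply: ltN; rewrite inE c'phi orbT.
have {}ltN x : x \in c -> x.1 < N by apply: ltN; rewrite mem_head.
rewrite size_cat /= mulSn addnC leq_add //; first by rewrite leq_addl.
elim: c ltN => //= x c IHc ltN; rewrite size_cat mulSn leq_add //.
  rewrite !size_cat !size_move_code /=; have := ltN x (mem_head _ _); lia.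
by apply: IHc => y yc; apply: ltN; rewrite inE yc orbT.
Qed.

Lemma sat_eq_in (rho sigma : nat -> bool) (N : nat) (phi : cnf nat) :
  (forall c x, c \in phi -> x \in c -> x.1 < N) ->
  (forall v, v < N -> rho v = sigma v) -> sat rho phi = sat sigma phi.
Proof.
move=> ltN eq_rs; apply: eq_in_all => c cphi; apply: eq_in_has => x xc.
by rewrite /lit_holds eq_rs // (ltN c).
Qed.

Lemma poly_cnf_NP_poly (L : language) : poly_cnf L -> NP_poly L.
Proof.
case=> q /choice[phi phiP].
(* The certificate lists the values of all variables, including the [n] input bits. *)
pose N n := q.[n]%R + n; pose advice n := rev (program n (N n) (phi n)).
exists (fun w => exists u, size u <= size w /\ ev_verdict (w, u)), advice.
have [q' q'P] : pbounded (fun n =>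
    6 * N n + q.[n]%R * (6 * N n + 3) + 3 * n + 3).
  have pN : pbounded N by rewrite /N; pbound.
  by pbound.
have ltN n (c : seq (nat * bool)) x : c \in phi n -> x \in c -> x.1 < N n.
  have [_ lt_phi _] := phiP n.
  by move=> cphi /(lt_phi _ _ cphi)/leq_trans; apply; apply: leq_addr.
exists q'; split.
- exists ev_verdict, 'X%R; split; first exact: ev_poly_time.
  by move=> w; rewrite hornerX.
- move=> n; rewrite size_rev; apply: leq_trans (q'P n).
  apply: leq_trans (size_program _ (ltN n)) _; have [le_phi _ _] := phiP n.
  by rewrite !leq_add2r leq_add2l leq_mul.
move=> x; have [_ _ /(_ x (erefl _))Lx] := phiP (size x).
rewrite Lx; split=> [[rho [rho_x sat_rho]]|[u [_]]].
  exists (mkseq rho (N (size x))); rewrite verdict_program //.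
  have nth_u v : v < N (size x) -> nth false (mkseq rho (N (size x))) v = rho v.
    by move=> ltv; rewrite nth_mkseq.
  split.
    rewrite size_mkseq /code_pair size_cat /= size_rev /program !size_cat.
    by rewrite !size_move_code; lia.
  rewrite (sat_eq_in (ltN _) nth_u) sat_rho /=; apply/eqP.
  apply: (@eq_from_nth _ false); rewrite ?size_mkseq // => j ltj.
  by rewrite nth_mkseq // nth_u ?rho_x // ltn_addl.
rewrite verdict_program // => /andP[sat_u /eqP eq_x].
exists (nth false u); split=> // j ltj.
by rewrite [in RHS]eq_x nth_mkseq.
Qed.

(** * From NP to formulas *)

Definition run_output (M : tm) (V : Type) (T : nat) (tmpl : seq (entry V))
    (rho : V -> bool) : seq bool :=
  tm_output (iter T (@tm_step M) (tm_init M [seq entry_val rho e | e <- tmpl])).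

(* The first summand of the variables of the templates stands for the input. *)
Lemma cnf_represents_runs (M : tm) (W A : eqType) (s : seq A)
    (tmpl : A -> seq (entry (nat + W))) (T : A -> nat) (z : A -> seq bool)
    (n b : nat) (P : seq bool -> Prop) :
  (forall a, a \in s -> T a + size (z a) <= b) ->
  (forall x, size x = n -> P x <-> exists2 a, a \in s & exists rho,
     (forall j, j < n -> rho (inl j) = nth false x j) /\
     prefix (run_output M (T a) (tmpl a) rho) (z a)) ->
  cnf_represents n
    (n + (1 + size s + size s * (2 * (run_cnf_const M * (b + 3) ^ 2)))) P.
Proof.
move=> leb PP; pose phi := or_cnf s (fun a => run_cnf M (T a) (tmpl a) (z a)).
have le_phi : cnf_size phi <= 1 + size s + size s * (2 * (run_cnf_const M * (b + 3) ^ 2)).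
  apply: or_cnf_size => a a_s; apply: leq_trans (run_cnf_size _ _ _ _) _.
  by rewrite leq_mul // leq_exp2r // leq_add2r leb.
have [|psi [size_psi lt_psi psiP]] := @cnf_rename _ (fun j => inl (inl (inl j))) n phi.
  by move=> j j' [].
exists psi; split.
- by rewrite size_psi (leq_trans le_phi) // leq_addl.
- by move=> c x cpsi xc; apply: leq_trans (lt_psi _ _ cpsi xc) _; rewrite leq_add2l.
move=> x size_x; rewrite PP // -psiP.
split=> [[a a_s [rho [rho_x]]]|[rho [rho_x]]].
  move/run_cnfP => [rho' sat_a].
  have /or_cnfP[sel sat_phi] : exists2 a, a \in s &
      sat (sum_val rho rho') (run_cnf M (T a) (tmpl a) (z a)) by exists a.
  by exists (sum_val (sum_val rho rho') sel).
rewrite (eq_sat (sum_val_split rho)) => sat_phi.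
have /or_cnfP[a a_s] : exists sel, sat (sum_val (fun v => rho (inl v)) sel) phi.
  by exists (fun a => rho (inr a)).
rewrite (eq_sat (sum_val_split _)) => sat_a.
exists a => //; exists (fun v => rho (inl (inl v))); split=> //.
by apply/run_cnfP; exists (fun f => rho (inl (inr f))).
Qed.

Lemma map_code_pair (V : Type) (rho : V -> bool) (s1 s2 : seq (entry V)) :
  map (entry_val rho) (flatten [seq [:: inl true; e] | e <- s1] ++ inl false :: s2) =
  code_pair (map (entry_val rho) s1, map (entry_val rho) s2).
Proof.
rewrite map_cat /code_pair /=; congr (_ ++ _).
by elim: s1 => //= e s1 ->.
Qed.

(** The template and the running time depend on the length of the certificate, so the formula is a
    disjunction over all lengths [m <= q.[n]]. *)
Lemma NP_poly_cnf (L : language) : NP L -> poly_cnf L.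
Proof.
case=> V [q [[M [p MP]] LV]].
pose tmpl n m : seq (entry (nat + nat)) :=
  flatten [seq [:: inl true; e] | e <- [seq inr (inl j, true) | j <- iota 0 n]] ++
  inl false :: [seq inr (inr j, true) | j <- iota 0 m].
have size_tmpl n m : size (tmpl n m) = 2 * n + 1 + m.
  by rewrite size_cat size_flatten_pairs /= !size_map !size_iota addn1 addSnnS.
pose b n := p.[(2 * n + 1 + q.[n]%R)%N]%R + 1.
suffices repr n : cnf_represents n
    (n + (1 + (q.[n]%R + 1) + (q.[n]%R + 1) * (2 * (run_cnf_const M * (b n + 3) ^ 2)))) L.
  have [q' q'P] : pbounded (fun n => n + (1 + (q.[n]%R + 1) + (q.[n]%R + 1) *
      (2 * (run_cnf_const M * (b n + 3) ^ 2)))).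
    have pb : pbounded b by rewrite /b; pbound.
    by pbound.
  exists q' => n; have [phi [size_phi lt_phi phiP]] := repr n.
  exists phi; split=> //; first exact: leq_trans size_phi (q'P n).
  by move=> c x cphi xc; apply: leq_trans (lt_phi _ _ cphi xc) (q'P n).
rewrite -(size_iota 0 (q.[n]%R + 1)).
(* The output is a single bit, so being a prefix of [[:: true]] means being equal to it. *)
apply: (@cnf_represents_runs M nat nat _ (tmpl n)
  (fun m => p.[(2 * n + 1 + m)%N]%R) (fun=> [:: true])).
  move=> m; rewrite mem_iota addn1 ltnS /= => lem.
  by rewrite leq_add2r horner_mono // leq_add2l.
move=> x size_x.
have out_V rho m : (forall j, j < n -> rho (inl j) = nth false x j) ->
    run_output M (p.[(2 * n + 1 + m)%N]%R) (tmpl n m) rho =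
    [:: V (x, mkseq (fun j => rho (inr j)) m)].
  move=> rho_x; have [_] := MP (x, mkseq (fun j => rho (inr j)) m).
  rewrite /run_output map_code_pair.
  have -> : map (entry_val rho) [seq inr (inl j, true) | j <- iota 0 n] = x.
    apply: (@eq_from_nth _ false); rewrite -map_comp size_map size_iota // => j ltj.
    by rewrite (nth_map 0) ?size_iota // nth_iota //= /lit_holds /= eqb_id rho_x.
  have -> : map (entry_val rho) [seq inr (inr j, true) | j <- iota 0 m] =
      mkseq (fun j => rho (inr j)) m.
    by rewrite -map_comp; apply: eq_map => j; rewrite /= /lit_holds eqb_id.
  by rewrite size_code_pair size_mkseq size_x.
rewrite LV; split=> [[u [size_u Vu]]|[m]].
  exists (size u); first by rewrite mem_iota addn1 ltnS -size_x.
  exists (fun v => match v with inl j => nth false x j | inr j => nth false u j end).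
  by split=> //; rewrite out_V // mkseq_nth Vu.
rewrite mem_iota addn1 ltnS /= => lem [rho [rho_x]]; rewrite out_V // /= andbT.
move/eqP=> Vx; exists (mkseq (fun j => rho (inr j)) m).
by rewrite size_mkseq size_x Vx.
Qed.

(** * From a kernel to formulas *)

Section OrdGraph.
Variables (V : finType) (G : sgraph V).

Definition ord_adj : rel 'I_#|V| := fun i j => G (enum_val i) (enum_val j).

Lemma ord_adj_sym : symmetric ord_adj.
Proof. by move=> i j; apply: adj_sym. Qed.

Lemma ord_adj_irr : irreflexive ord_adj.
Proof. by move=> i; apply: adj_irr. Qed.

Definition ord_graph : graph := existT _ #|V| (SGraph ord_adj_sym ord_adj_irr).

Lemma ord_graph_contractible k :
  tree_contractible (tagged ord_graph) k <-> tree_contractible G k.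
Proof.
split; apply: tree_contractible_iso; last first.
  by exists enum_val; split; first exact: enum_val_bij.
exists enum_rank; split; first exact: enum_rank_bij.
by move=> x y; rewrite /= /ord_adj !enum_rankK.
Qed.
End OrdGraph.

Lemma nseq_cat_inj (b : bool) (m n : nat) (s s' : seq bool) :
  nseq m b ++ ~~ b :: s = nseq n b ++ ~~ b :: s' -> m = n /\ s = s'.
Proof.
by case: b; elim: m n => [|m IHm] [|n] //= [] => [->|/IHm[-> ->]].
Qed.

Lemma code_graph_contractible (G H : graph) (k : nat) :
  code_graph G = code_graph H ->
  tree_contractible (tagged G) k -> tree_contractible (tagged H) k.
Proof.
case: G H => [n G] [m H] /(@nseq_cat_inj true) /= [eq_nm].
rewrite -{m}eq_nm in H * => eq_GH; apply: tree_contractible_iso.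
exists id; split=> [|i j]; first by exists id.
have map_pairs (F : sgraph 'I_n) : [seq F i j | i <- enum 'I_n, j <- enum 'I_n] =
    map (fun x => F x.1 x.2) [seq (i, j) | i <- enum 'I_n, j <- enum 'I_n].
  by rewrite map_allpairs.
rewrite !map_pairs in eq_GH; apply: (eq_in_map _ _ _).2 eq_GH (i, j) _.
by apply: allpairs_f; rewrite mem_enum.
Qed.

(** Since the unary parameter stands last, the prefix test admits exactly the same graph with a
    parameter that is not larger. *)
Lemma code_pair_prefix (s1 s2 : seq bool) (k1 k2 : nat) :
  prefix (code_pair (s1, nseq k1 true)) (code_pair (s2, nseq k2 true)) =
  (s1 == s2) && (k1 <= k2).
Proof.
rewrite /code_pair /=; elim: s1 s2 => [|b s1 IHs] [|c s2] //=.
  by elim: k1 k2 => [|k1 IHk] [|k2] //=.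
by rewrite IHs eqseq_cons andbA.
Qed.

(** * The contraction instance of a tuple of inputs, as a template *)

Section OrInstance.
Variables (n N l : nat) (phi : cnf nat).

Definition or_param : nat := cover_param (or_elt N l phi) N.+1.

Definition or_vertex : finType := cover_vertex (or_elt N l phi) (or_set N l) N.+1.

Definition or_graph (rho : or_index l * nat -> bool) : sgraph or_vertex :=
  cover_graph N.+1 (fun (r : or_set N l) (b : or_elt N l phi) => entry_val rho (or_entry n r b)).

Definition or_instance (rho : or_index l * nat -> bool) : graph * nat :=
  (ord_graph (or_graph rho), or_param).

Definition or_graph_tmpl : seq (entry (or_index l * nat)) :=
  nseq #|or_vertex| (inl true) ++ inl false ::
  [seq cover_entry (inl false) (inl true)
     (fun (r : or_set N l) (b : or_elt N l phi) => or_entry n r b)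
     (enum_val i : or_vertex) (enum_val j)
  | i <- enum 'I_#|or_vertex|, j <- enum 'I_#|or_vertex|].

Definition or_tmpl : seq (entry (or_index l * nat)) :=
  flatten [seq [:: inl true; e] | e <- or_graph_tmpl] ++
  inl false :: nseq or_param (inl true).

Lemma or_tmplE rho :
  map (entry_val rho) or_tmpl = @code_param Tree_Contractibility (or_instance rho).
Proof.
rewrite map_code_pair /code_param map_nseq; congr (code_pair (_, _)).
rewrite map_cat map_nseq /= map_allpairs /code_graph /=; congr (_ ++ _ :: _).
by apply: eq_allpairs => // i j; apply: cover_entry_map.
Qed.

Lemma or_instanceP rho :
  (forall c x, c \in phi -> x \in c -> x.1 < N) ->
  tree_contractible (tagged (or_instance rho).1) (or_instance rho).2 <->
  exists i sigma, (forall j, j < n -> sigma j = rho (i, j)) /\ sat sigma phi.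
Proof.
move=> ltN; apply: iff_trans (ord_graph_contractible _ _) _.
apply: iff_trans (or_cover n rho ltN).
exact: (@cover_contractible (or_elt N l phi) (or_set N l) N.+1
  (fun r b => entry_val rho (or_entry n r b))).
Qed.

Lemma or_paramE : or_param = N.+1 + (size phi + N * l * 2) + N.+1.
Proof. by rewrite /or_param /cover_param card_or_elt. Qed.

Lemma card_or_vertex :
  #|or_vertex| =
  (N.+1 + (size phi + N * l * 2) + (2 ^ l + 2 ^ l * N * 2) * or_param.+2).+1.
Proof.
by rewrite card_option card_sum card_or_elt card_prod card_or_set card_ord.
Qed.

Lemma size_or_tmpl :
  size or_tmpl = 2 * (#|or_vertex| + (#|or_vertex| ^ 2).+1) + 1 + or_param.
Proof.
rewrite size_cat size_flatten_pairs size_cat /= !size_nseq size_allpairs.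
by rewrite !size_enum_ord mulnn addn1 addSnnS.
Qed.
End OrInstance.

Lemma cnf_represents_leq (n s s' : nat) (P : seq bool -> Prop) :
  s <= s' -> cnf_represents n s P -> cnf_represents n s' P.
Proof.
move=> les [phi [le_phi lt_phi phiP]]; exists phi; split=> //.
  exact: leq_trans les.
by move=> c x cphi xc; apply: leq_trans (lt_phi _ _ cphi xc) les.
Qed.

(** * The formula obtained from a kernel *)

Section KernelCnf.
Variables (g : nat -> nat) (K : graph * nat -> graph * nat) (M : tm) (p : {poly nat}).
Hypothesis KM : forall Ik : graph * nat,
  tm_computes M (@code_param Tree_Contractibility Ik)
    (@code_param Tree_Contractibility (K Ik))
    p.[size (@code_param Tree_Contractibility Ik)]%R.
Hypothesis K_yes : forall (G : graph) (k : nat), tree_contractible (tagged G) k <->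
  tree_contractible (tagged (K (G, k)).1) (K (G, k)).2.
Hypothesis K_size : forall (G : graph) (k : nat), size (code_graph (K (G, k)).1) <= g k.

Variables (L : language) (n N l : nat) (phi : cnf nat).
Hypothesis ltN : forall c x, c \in phi -> x \in c -> x.1 < N.
Hypothesis phiP : forall x, size x = n ->
  ~ L x <-> exists rho, (forall j, j < n -> rho j = nth false x j) /\ sat rho phi.
Hypothesis lt_g : g (or_param N l phi) < 2 ^ l.

Let I : finType := or_index l.
Let tmpl : seq (entry (I * nat)) := or_tmpl n N l phi.
Let T : nat := p.[size tmpl]%R.
Let inst (rho : I * nat -> bool) : graph * nat := or_instance n N phi rho.
Let out (rho : I * nat -> bool) : seq bool := run_output M T tmpl rho.
Let row (rho : I * nat -> bool) (i : I) : seq bool := mkseq (fun j => rho (i, j)) n.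

Lemma outE rho : out rho = code_pair (code_graph (K (inst rho)).1, nseq (K (inst rho)).2 true).
Proof.
have [_ /=] := KM (inst rho); rewrite -[code_param _]or_tmplE size_map => eq_out.
exact: eq_out.
Qed.

Lemma inst_yes rho :
  tree_contractible (tagged (K (inst rho)).1) (K (inst rho)).2 <->
  exists i, ~ L (row rho i).
Proof.
rewrite -K_yes; apply: iff_trans (or_instanceP _ _ ltN) _.
split=> [[i [sigma [sigma_i sat_phi]]]|[i /(phiP (size_mkseq _ _))[sigma [sigma_i sat_phi]]]].
  exists i; apply/phiP; first exact: size_mkseq.
  by exists sigma; split=> // j ltj; rewrite nth_mkseq ?sigma_i.
by exists i, sigma; split=> // j ltj; rewrite sigma_i // nth_mkseq.
Qed.

(** The two outputs have the same graph, and [rho'] has at least the parameter of [rho]. If some row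
    of [rho] were outside [L], its output would be a yes-instance, and so would that of [rho']. *)
Lemma out_prefix rho rho' :
  prefix (out rho) (out rho') -> (forall i, L (row rho' i)) ->
  forall i, L (row rho i).
Proof.
rewrite !outE code_pair_prefix => /andP[/eqP eq_code lek] L_rho' i.
apply: contrapT => nLi; have : exists i, ~ L (row rho i) by exists i.
case/inst_yes/(code_graph_contractible eq_code)/(tree_contractible_leq lek)/inst_yes.
by move=> i' /(_ (L_rho' i')).
Qed.

Let rho_of (f : {ffun I -> n.-tuple bool}) (x : I * nat) : bool := nth false (f x.1) x.2.

Let small (f : {ffun I -> n.-tuple bool}) : seq bool := code_graph (K (inst (rho_of f))).1.

(** The code of the reduced graph has less than [2 ^ l] bits. A mark and zeros extend it reversibly
    to exactly [2 ^ l] bits, so that [F] has at most [2 ^ #|I|] values, as covering by tuples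
    requires. *)
Let padded (f : {ffun I -> n.-tuple bool}) : seq bool :=
  small f ++ true :: nseq (2 ^ l - (size (small f)).+1) false.

Let F (f : {ffun I -> n.-tuple bool}) : (2 ^ l).-tuple bool :=
  [tuple nth false (padded f) i | i < 2 ^ l].

Lemma row_rho_of f i : row (rho_of f) i = f i.
Proof.
apply: (@eq_from_nth _ false); rewrite size_mkseq ?size_tuple // => j ltj.
by rewrite nth_mkseq.
Qed.

Lemma F_inj f f' : F f = F f' -> small f = small f'.
Proof.
have size_pad h : size (padded h) = 2 ^ l.
  rewrite size_cat /= size_nseq addnS -addSn subnKC //.
  by apply: leq_ltn_trans lt_g; apply: K_size.
move=> eqF; have : padded f = padded f'.
  apply: (@eq_from_nth _ false); rewrite !size_pad // => j ltj.
  by have := congr1 (fun t => tnth t (Ordinal ltj)) eqF; rewrite !tnth_mktuple.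
rewrite /padded; move: (small f) (small f') => s s' /(congr1 rev).
rewrite !rev_cat !rev_cons !rev_nseq -!cats1 -!catA.
by case/(@nseq_cat_inj false)=> _; apply: (can_inj revK).
Qed.

(* [g] does not bound the parameter computed by the kernel; but a no-instance
   remains one when its parameter decreases, so that for each graph it suffices
   to list the largest parameter. *)
Lemma fiber_output_bound (y : (2 ^ l).-tuple bool) : exists z,
  [/\ size z <= size tmpl + T.+1,
      forall f : {ffun I -> n.-tuple bool}, (forall i, L (f i)) -> F f = y ->
        prefix (out (rho_of f)) z
    & forall rho, prefix (out rho) z -> forall i, L (row rho i)].
Proof.
pose D := [set f : {ffun I -> n.-tuple bool} | [forall i, `[< L (f i) >]] && (F f == y)].
have inD f : f \in D <-> (forall i, L (f i)) /\ F f = y.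
  rewrite inE; split=> [/andP[/forallP Lf /eqP Ff]|[Lf ->]].
    by split=> // i; apply/asboolP.
  by rewrite eqxx andbT; apply/forallP => i; apply/asboolP.
have [D0|[f0 f0D]] := set_0Vmem D.
  (* An output is never empty, so none is a prefix of the empty [z]. *)
  exists [::]; split=> // [f Lf Ff|rho].
    by have : f \in D; [apply/inD | rewrite D0 inE].
  by rewrite outE /code_pair /=; case: flatten.
pose m (f : {ffun I -> n.-tuple bool}) := (K (inst (rho_of f))).2.
case: (arg_maxnP (P := [in D]) m f0D) => f /inD[Lf Ff] f_max.
exists (out (rho_of f)); split=> [|f' Lf' Ff'|rho pre].
- by apply: leq_trans (size_tm_output _ _ _) _; rewrite size_map.
- rewrite !outE code_pair_prefix; apply/andP; split; last first.
    by apply: f_max; apply/inD.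
  by apply/eqP/F_inj; rewrite Ff.
by apply: out_prefix pre _ => i; rewrite row_rho_of.
Qed.

(** Here [s] bounds the number of disjuncts: at most [n + 1] values [y] of [F], and [2 ^ l]
    positions of the input in the tuple. *)
Definition kernel_cnf_size : nat :=
  let s := n.+1 * 2 ^ l in
  n + (1 + s + s * (2 * (run_cnf_const M * (T + (size tmpl + T.+1) + 3) ^ 2))).

Lemma kernel_cnf : cnf_represents n kernel_cnf_size L.
Proof.
have /choice[z zP] := fiber_output_bound.
pose S := [set x : n.-tuple bool | `[< L x >]].
have card_I : #|I| = 2 ^ l by rewrite card_ffun card_ord card_bool.
(* At most [2 ^ n] inputs have to be covered, which is less than [2 ^ n.+1]; hence [n + 1]
   values. *)
have [|||ys [size_ys cov_ys]] := @tuple_cover _ _ _ F n.+1 S.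
- by rewrite card_I expn_gt0.
- by rewrite card_tuple card_bool card_I.
- apply: leq_ltn_trans (max_card _) _; rewrite card_tuple card_bool.
  by rewrite ltn_exp2l.
pose s := [seq (y, i) | y <- ys, i <- enum I].
(* Row [i] of the tuple is identified with the actual input; the other rows remain existential. *)
pose ren i (x : I * nat) : nat + I * nat := if x.1 == i then inl x.2 else inr x.
pose ren_entry i (e : entry (I * nat)) : entry (nat + I * nat) :=
  match e with inl b => inl b | inr (x, b) => inr (ren i x, b) end.
have out_ren i (sigma : nat + I * nat -> bool) :
    run_output M T (map (ren_entry i) tmpl) sigma = out (fun x => sigma (ren i x)).
  rewrite /out /run_output -map_comp; congr (tm_output (iter _ _ (tm_init _ _))).
  by apply: eq_map => -[b|[x b]].
have le_s : size s <= n.+1 * 2 ^ l.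
  by rewrite size_allpairs -cardE card_I leq_mul.
pose b := T + (size tmpl + T.+1).
have /cnf_represents_leq : n + (1 + size s + size s * (2 * (run_cnf_const M * (b + 3) ^ 2)))
    <= kernel_cnf_size.
  by rewrite leq_add2l leq_add ?leq_add2l // leq_mul.
apply; apply: (@cnf_represents_runs M _ _ s (fun a => map (ren_entry a.2) tmpl)
  (fun=> T) (fun a => z a.1)).
  by move=> a _; rewrite leq_add2l; have [] := zP a.1.
move=> x size_x; split=> [Lx|[[y i] _ [sigma [sigma_x]]]].
  have [|f [fS Ff [i fi]]] := cov_ys (tcast size_x (in_tuple x)).
    by rewrite inE; apply/asboolP; rewrite val_tcast.
  have fi_x : f i = x :> seq bool by rewrite fi val_tcast.
  exists (F f, i); first by apply: allpairs_f => //; rewrite mem_enum.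
  exists (sum_val (nth false x) (rho_of f)); split=> //=.
  rewrite out_ren; have -> : (fun x0 => sum_val (nth false x) (rho_of f) (ren i x0)) = rho_of f.
    apply/funext => -[i' j]; rewrite /ren /=; case: eqP => //= ->.
    by rewrite /rho_of /= fi_x.
  have [_ pre _] := zP (F f); apply: pre => // i'.
  by have := fS i'; rewrite inE => /asboolP.
rewrite out_ren => pre; have [_ _ /(_ _ pre i)] := zP y.
congr L; apply: (@eq_from_nth _ false); rewrite size_mkseq // => j ltj.
by rewrite nth_mkseq // /ren /= eqxx sigma_x.
Qed.
End KernelCnf.

(** * Choice of the tuple length *)

Lemma horner_lt_exp (q : {poly nat}) :
  exists C d, [/\ 0 < C, 0 < d & forall n, q.[n]%R < C * n.+1 ^ d].
Proof.
exists (\sum_(i < size q) nth 0 q i).+1, (size q).+1; split=> // n.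
rewrite hornerE_nat mulSn -add1n; apply: leq_add; first by rewrite expn_gt0.
rewrite big_distrl /=; apply: leq_sum => i _; rewrite leq_mul //.
apply: leq_trans (leq_pexp2l (ltn0Sn n) (ltnW (leqW (ltn_ord i)))).
by case: (nat_of_ord i) => // k; rewrite leq_exp2r.
Qed.

Lemma up_log_leq (m : nat) : 0 < m -> 2 ^ up_log 2 m <= 2 * m.
Proof.
case: m => [|[|m]] // _; rewrite -[up_log _ _]prednK ?up_log_gt0 // expnS.
by rewrite leq_mul // ltnW // up_log_gtn.
Qed.

(** The parameter of the instance grows with [l] itself, so [l] has to solve
    [C * (a * (l + 1)) ^ d <= 2 ^ l]. This solution is logarithmic in [a], so [2 ^ l] stays
    polynomial. *)
Definition tuple_log (C d a : nat) : nat := 2 * d * up_log 2 (C * a * (2 * d).+1).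

Section TupleLength.
Variables (C d a : nat).
Hypotheses (C_gt0 : 0 < C) (d_gt0 : 0 < d) (a_gt0 : 0 < a).

(* With [h := up_log 2 (C * a * (2 * d + 1))], the factor [(tuple_log + 1) ^ d]
   is at most [((2 * d + 1) * 2 ^ h) ^ d] since [h + 1 <= 2 ^ h]. *)
Lemma tuple_log_geq k :
  k.+1 <= a * (tuple_log C d a).+1 -> C * k.+1 ^ d <= 2 ^ tuple_log C d a.
Proof.
rewrite /tuple_log; set h := up_log _ _ => lek.
have leh : C * a * (2 * d).+1 <= 2 ^ h by apply: up_logP.
have lek' : k.+1 <= a * ((2 * d).+1 * 2 ^ h).
  apply: leq_trans lek _; rewrite leq_mul //.
  have : h < 2 ^ h by apply: ltn_expl.
  by move: (2 ^ h) => x; nia.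
have leC : C * k.+1 ^ d <= (C * k.+1) ^ d.
  by rewrite expnMn leq_mul // -{1}[C]expn1 leq_pexp2l.
have -> : 2 ^ (2 * d * h) = (2 ^ h * 2 ^ h) ^ d.
  by rewrite -expnD addnn -mul2n -expnM mulnAC.
apply: leq_trans leC _; rewrite leq_exp2r //.
by apply: leq_trans (leq_mul (leqnn C) lek') _; rewrite !mulnA leq_mul.
Qed.

Lemma tuple_log_leq : 2 ^ tuple_log C d a <= (2 * (C * a * (2 * d).+1)) ^ (2 * d).
Proof.
rewrite /tuple_log mulnC expnM leq_exp2r ?muln_gt0 // up_log_leq //.
by rewrite !muln_gt0 C_gt0 a_gt0.
Qed.
End TupleLength.

Theorem theorem5 :
  ~ (forall L : language, coNP L -> NP_poly L) ->
  ~ has_polynomial_kernel Tree_Contractibility.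
Proof.
move=> not_sub [g [K [[M [p KM]] K_yes K_size]]]; apply: not_sub => L coNP_L.
apply: poly_cnf_NP_poly; have [q /choice[phi phiP]] := NP_poly_cnf coNP_L.
have [C [d [C_gt0 d_gt0 ltg]]] := horner_lt_exp g.
(* As [size (phi n) <= N n], the parameter plus one is at most
   [3 * N + 3 + 2 * N * l <= a * (l + 1)]. *)
pose N n := q.[n]%R; pose a n := 3 * N n + 3.
(* The polynomially bounded [t] replaces both [l] and [2 ^ l] in the estimates below. *)
pose l n := tuple_log C d (a n); pose t n := (2 * (C * a n * (2 * d).+1)) ^ (2 * d).
have a_gt0 n : 0 < a n by rewrite /a addnS.
have le_t n : 2 ^ l n <= t n by apply: tuple_log_leq.
have le_l n : l n <= t n by apply: leq_trans (le_t n); apply/ltnW/ltn_expl.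
have le_phi n : size (phi n) <= N n.
  have [le_phi _ _] := phiP n; apply: leq_trans le_phi.
  by elim: (phi n) => //= c psi; rewrite cnf_size_cons; lia.
pose kb n := a n * (t n).+1.
have le_param n : (or_param (N n) (l n) (phi n)).+1 <= a n * (l n).+1 /\
    (or_param (N n) (l n) (phi n)).+1 <= kb n.
  have le_a : (or_param (N n) (l n) (phi n)).+1 <= a n * (l n).+1.
    by rewrite or_paramE /a; have := le_phi n; nia.
  by split; last by apply: leq_trans le_a _; rewrite leq_mul // ltnS.
pose vb n := (kb n + (t n + t n * N n * 2) * (kb n).+2).+1.
have le_vertex n : #|or_vertex (N n) (l n) (phi n)| <= vb n.
  rewrite card_or_vertex ltnS; have [_] := le_param n; rewrite or_paramE => lek.
  apply: leq_add; first by lia.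
  by rewrite leq_mul ?leq_add ?leq_mul // ltnS; lia.
pose sb n := 2 * (vb n + (vb n ^ 2).+1) + 1 + kb n.
have le_tmpl n : size (or_tmpl n (N n) (l n) (phi n)) <= sb n.
  rewrite size_or_tmpl leq_add ?(ltnW (le_param n).2) // leq_add2r leq_mul2l /=.
  by rewrite leq_add // ltnS leq_exp2r.
pose Tb n := p.[sb n]%R.
pose bound n := n + (1 + n.+1 * t n + n.+1 * t n *
  (2 * (run_cnf_const M * (Tb n + (sb n + (Tb n).+1) + 3) ^ 2))).
have [q' q'P] : pbounded bound.
  have pN : pbounded N by rewrite /N; pbound.
  have pa : pbounded a by rewrite /a; pbound.
  have pt : pbounded t by rewrite /t; pbound.
  have pk : pbounded kb by rewrite /kb; pbound.
  have pv : pbounded vb by rewrite /vb; pbound.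
  have ps : pbounded sb by rewrite /sb; pbound.
  have pT : pbounded Tb by rewrite /Tb; pbound.
  by rewrite /bound; pbound.
exists q' => n; apply: cnf_represents_leq (q'P n) _.
have [_ ltN phi_L] := phiP n.
have lt_g : g.[or_param (N n) (l n) (phi n)]%R < 2 ^ l n.
  by apply: leq_trans (ltg _) _; apply: tuple_log_geq => //; have [] := le_param n.
have := kernel_cnf KM K_yes K_size ltN phi_L lt_g.
apply: cnf_represents_leq.
rewrite /kernel_cnf_size /bound.
have le_T : p.[size (or_tmpl n (N n) (l n) (phi n))]%R <= Tb n by apply: horner_mono.
have le_s : n.+1 * 2 ^ l n <= n.+1 * t n by rewrite leq_mul.
rewrite leq_add2l leq_add ?leq_add2l // leq_mul // !leq_mul2l leq_exp2r ?orbT //.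
by rewrite leq_add2r !leq_add // !ltnS.
Qed.
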